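(* Let $\bm{F}=(F_1,\dots,F_K)\in\mathcal{A}^K$ and suppose that for some $j$ one has $\mu_j=\mu^*$ and $\mu_i<\mu^*$ for all $i\neq j$. Then under the MED policy, for every $i\neq j$ and every $\epsilon>0$, $$\mathrm{E}_{\bm{F}}[T_i(N)]\le \frac{1+\epsilon}{D_{\min}(F_i,\mu^*,\mathcal{A})}\log N+\mathrm{O}(1)\qquad (N\to\infty).$$
   Context: Model. $\mathcal{A}$ is the family of probability distributions $F$ on $\mathbb{R}$ whose support $\mathrm{supp}(F)$ is a finite subset of $[-1,0]$. $\mathrm{E}(F)$ is the mean of $F$. The Kullback-Leibler divergence is $D(F\|G)=\mathrm{E}_F[\log\frac{\mathrm{d}F}{\mathrm{d}G}]$ if $\frac{\mathrm{d}F}{\mathrm{d}G}$ exists and $+\infty$ otherwise. For $F\in\mathcal{A}$ and $\mu\le 0$, $$D_{\min}(F,\mu,\mathcal{A})=\min_{G\in\mathcal{A}:\,\mathrm{E}(G)\ge\mu}D(F\|G)\in[0,+\infty].$$ Bandit. There are $K$ arms $\Pi_1,\dots,\Pi_K$. Each pull of $\Pi_j$ yields a reward drawn from $F_j$, independently of everything else. Put $\mu_j=\mathrm{E}(F_j)$ and $\mu^*=\max_j\mu_j$. $J_n$ is the index of the arm pulled in round $n$, $T_j(n)=\sum_{m=1}^n\mathbb{I}[J_m=j]$, and $T_j'(n)=T_j(n-1)$. $\hat F_j(n)$ is the empirical distribution of the $T_j'(n)$ rewards obtained from $\Pi_j$ in the first $n-1$ rounds, $\hat\mu_j(n)=\mathrm{E}(\hat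 F_j(n))$, and $\hat\mu^*(n)=\max_j\hat\mu_j(n)$. MED (minimum empirical divergence) policy. First pull each arm once (rounds $1,\dots,K$). In each subsequent round $n$, compute $\hat D_j(n)=D_{\min}(\hat F_j(n),\hat\mu^*(n),\mathcal{A})$ for each $j$ and choose $J_n=j$ at random (given the past) with probability $$p_j(n)=\frac{\exp(-T_j'(n)\hat D_j(n))}{\sum_{i=1}^K\exp(-T_i'(n)\hat D_i(n))}.$$ $\mathrm{E}_{\bm{F}}$ is the expectation over rewards and over the randomization of the policy. Conventions: $\exp(-\infty)=0$ and $1/\infty=0$. *)

(* Defs.v *)
From HB Require Import structures.
From mathcomp Require Import all_boot all_order all_algebra.
From mathcomp Require Import all_classical all_reals all_analysis.

Set Implicit Arguments.
Unset Strict Implicit.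
Unset Printing Implicit Defensive.

Import Order.TTheory GRing.Theory Num.Theory.
Import numFieldNormedType.Exports.

Local Open Scope classical_set_scope.
Local Open Scope ring_scope.
Local Open Scope ereal_scope.
Local Open Scope charge_scope.

Section Distributions.
Context {R : realType}.
Local Notation dist := (probability (measurableTypeR R) R).
Implicit Types F G : dist.

Definition supp F : set R :=
  [set x | forall U : set R, open_nbhs x U -> 0 < F U].

Definition finsupp_family : set dist :=
  [set F | finite_set (supp F) /\ supp F `<=` `[(-1)%R, 0%R]].

Definition mean F : \bar R := 'E_F[idfun].

(* On the finitely supported distributions used here, [`<<] (absolute
   continuity) is exactly the existence of the density dF/dG. *)
Definition KL F G : \bar R :=
  if pselect (F `<< G) is left _ then
    \int[F]_x lne (('d (charge_of_finite_measure F) '/d G) x)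
  else +oo.

(* On [finsupp_family] and for mu <= 0 this infimum is attained. *)
Definition Dmin F (mu : \bar R) : \bar R :=
  ereal_inf [set KL F G | G in finsupp_family `&` [set G | mu <= mean G]].

(* The uniform distribution on the list s (with multiplicities); the Dirac
   mass at 0 is a junk value, returned only for s = [::]. *)
Definition empirical (s : seq R) : dist :=
  mnormalize (msum (fun m => \d_(nth 0%R s m : measurableTypeR R)) (size s))
    \d_(0%R : measurableTypeR R).

End Distributions.

Section Bandit.
Context {R : realType} (K : nat).
Local Notation dist := (probability (measurableTypeR R) R).

(* The arms pulled and the rewards received so far, in chronological order. *)
Definition history : Type := seq ('I_K * R).

(* The probability of pulling each arm next, given the history. *)
Definition policy : Type := history -> 'I_K -> R.

(* A genuine maximum as soon as 0 < K, which [k : 'I_K] guarantees wherever it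
   is used. *)
Definition best_mean (F : 'I_K -> dist) : \bar R :=
  \big[maxe/-oo]_(k < K) mean (F k).

Definition rewards_of (h : history) (k : 'I_K) : seq R :=
  [seq x.2 | x <- h & x.1 == k].

Definition empirical_dist (h : history) (k : 'I_K) : dist :=
  empirical (rewards_of h k).

Definition med_divergence (h : history) (k : 'I_K) : \bar R :=
  Dmin (empirical_dist h k) (best_mean (empirical_dist h)).

(* [expeR -oo = 0], so an infinite divergence yields weight 0. *)
Definition med_weight (h : history) (k : 'I_K) : R :=
  fine (expeR (- ((size (rewards_of h k))%:R%:E * med_divergence h k))).

(* After n rounds [size h = n], and the next round is the (n+1)-th one: the
   first K rounds pull the arms in the order of their indices. *)
Definition med_policy : policy := fun h k =>
  if (size h < K)%N then (nat_of_ord k == size h)%:R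
  else (med_weight h k / \sum_(l < K) med_weight h l)%R.

Section Run.
Context {d : measure_display} {Omega : measurableType d}.
Context {P : probability Omega R}.
Variables (J : nat -> Omega -> 'I_K) (X : nat -> {RV P >-> R}).

(* Rounds are numbered from 0: [J n] and [X n] are the arm pulled and the
   reward received in the (n+1)-th round. *)
Definition history_after (n : nat) (w : Omega) : history :=
  [seq (J m w, X m w) | m <- iota 0 n].

Definition pulls (i : 'I_K) (N : nat) (w : Omega) : nat :=
  \sum_(m < N) (J m w == i).

(* P is a law of the bandit with arms F played with policy pi: given the
   history, the next arm is drawn from pi, and, given moreover that arm k is
   pulled, the reward has law F k.  Conditioning on individual histories
   suffices because the histories are discrete when every F k has finite
   support. *)
Record bandit_run (F : 'I_K -> dist) (pi : policy) : Prop := BanditRun {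
  arm_measurable : forall n (k : 'I_K), measurable [set w | J n w = k];
  arm_law : forall n (h : history) (k : 'I_K),
    P [set w | history_after n w = h /\ J n w = k] =
    P [set w | history_after n w = h] * (pi h k)%:E;
  reward_law : forall n (h : history) (k : 'I_K) (B : set R),
    measurable (B : set (measurableTypeR R)) ->
    P [set w | [/\ history_after n w = h, J n w = k & B (X n w)]] =
    P [set w | history_after n w = h /\ J n w = k] * F k B
}.

End Run.
End Bandit.
Arguments med_policy {R} K.

(* Main.v *)
Require Import Defs.
From mathcomp Require Import all_boot all_order all_algebra.
From mathcomp Require Import all_classical all_reals all_analysis.
From mathcomp Require Import measurable_realfun measurable_fun_approximation ring lra zify.
Import Order.TTheory GRing.Theory Num.Theory.
Import numFieldNormedType.Exports.
Local Open Scope classical_set_scope.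
Local Open Scope ring_scope.
Local Open Scope ereal_scope.
Set Implicit Arguments.
Unset Strict Implicit.
Unset Printing Implicit Defensive.
(** Write mu for the largest mean, D for the divergence D_min(F_i, mu), and
t for the number of pulls of the arm under consideration.  A round in which
the suboptimal arm i is pulled is charged to one of four causes.

- Arm i has been pulled fewer than L = log N / c + O(1) times, with
  c = D / (1 + eps).  This costs at most L pulls and is the main term.
- The empirical law of arm i has a wrong frequency at some atom.  Only pulls of
  arm i change that law, and by Chernoff the probability decays geometrically
  in the number of these pulls, so the total cost is O(1).
- The largest empirical mean has dropped below mu * (1 + l), which lies a
  little below mu.  Then so has the empirical mean of the optimal arm j.  Let G
  be the mixture (1 - d) F_j + d F^_j, where F^_j is the empirical law and d is
  small: its mean is still above the threshold, so
  D_min(F^_j, .) <= KL(F^_j, G) <= (1 - d) KL(F^_j, F_j), and arm j is pulled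
  with probability at least exp(- (1 - d) t KL(F^_j, F_j)) / K.  The expected
  number of such rounds is thus bounded by K times the sum over t of
  E[exp((1 - d) t KL(F^_j, F_j)); low empirical mean].  Up to a factor
  (1 + o(1))^t, the likelihood ratio exp(t KL) of the empirical law is below a
  finite sum of likelihood ratios of laws on a grid; the exponent 1 - d < 1
  leaves room for the Chernoff factor of the low mean, and the sum converges.
- None of these.  Then D_min(F^_i, .) >= c by continuity of D_min, and as
  t >= L the policy pulls arm i with probability at most 1 / N.  Over N rounds
  this costs at most 1.

Continuity of D_min is obtained on the primal side, without duality: a change of
the frequencies by a factor within 1 +- l and a mixture with the Dirac mass at 0,
which has the largest possible mean, both change the divergence by a controlled
amount ([KL_stable], [Dmin_relax], [Dmin_freq_close]).

All sums over rounds are handled by one potential argument.  A cost b, a function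
of the rewards x of one arm, has a drift if some B >= 0 satisfies
b x + E[B (x, a)] <= B x, where a is the next reward.  Then the total cost of b
over the pulls of that arm is at most B of the empty sequence
([drift_pulls_bound]).  Costs of product form have a drift as soon as one step
contracts ([has_drift_prod]), which is what Chernoff provides
([not_close_drift], [low_mean_drift]).

When mu = 0 the optimal arm always yields 0 and D = +oo.  As soon as arm i has
shown a negative reward in the right proportion, its divergence is infinite and
it is not pulled, so its expected number of pulls is bounded ([pulls_bounded]). *)

(** * Finitely supported laws *)

Section Finite_support.
Local Open Scope charge_scope.
Context {R : realType}.
Local Notation dist := (probability (measurableTypeR R) R).
Implicit Types (F G : dist) (s : seq R).

Definition atom F (x : R) : R := fine (F [set x]).

Lemma atomE F x : F [set x] = (atom F x)%:E.
Proof. by rewrite /atom fineK // fin_num_measure. Qed.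

Lemma atom_ge0 F x : (0 <= atom F x)%R.
Proof. by rewrite /atom fine_ge0. Qed.

Let set_cons1 (a : R) s : [set` a :: s] = [set a] `|` [set` s].
Proof.
apply/seteqP; split => x /=.
  by rewrite in_cons => /orP[/eqP ->|xs]; [left|right].
by rewrite in_cons => -[->|xs]; rewrite ?eqxx // xs orbT.
Qed.

Lemma measurable_seq s : measurable ([set` s] : set (measurableTypeR R)).
Proof.
elim: s => [|a s IH]; first by rewrite set_nil.
rewrite set_cons1; exact: measurableU.
Qed.

Lemma measurable_seqC s : measurable (~` [set` s] : set (measurableTypeR R)).
Proof. apply: measurableC; exact: measurable_seq. Qed.

Lemma measure_seq F s (A : set (measurableTypeR R)) : uniq s -> measurable A ->
  F (A `&` [set` s]) = (\sum_(x <- s | x \in A) atom F x)%:E.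
Proof.
elim: s => [|a s IH] /=; first by rewrite set_nil setI0 measure0 big_nil.
move=> /andP[nas us] mA; rewrite set_cons1 setIUr big_cons.
rewrite measureU; last 1 first.
- rewrite -subset0 => x [[_ ->] [_ /=]]; by rewrite (negbTE nas).
- have {}IH := IH us mA; case: ifPn; rewrite ?inE => aA.
    rewrite EFinD -atomE -IH; congr (F _ + _).
    by apply/seteqP; split => [x []//|x ->].
  rewrite -IH [X in (X + _)%R](_ : _ = 0) ?add0e //.
  rewrite -[RHS](measure0 F); congr (F _).
  by rewrite -subset0 => x [] /[swap] -> /= /mem_set; rewrite (negbTE aA).
- exact: measurableI.
- apply: measurableI => //; exact: measurable_seq.
Qed.

Lemma measure_atomic F s (A : set (measurableTypeR R)) :
  uniq s -> F (~` [set` s]) = 0 -> measurable A ->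
  F A = (\sum_(x <- s | x \in A) atom F x)%:E.
Proof.
move=> us F0 mA; rewrite -measure_seq //.
have ms := measurable_seq s.
rewrite -[in LHS](setUIDK A [set` s]) measureU ?setDE; last first.
- by rewrite setIACA setICr setI0.
- by apply: measurableI => //; exact: measurableC.
- exact: measurableI.
rewrite [X in _ + X](_ : _ = 0) ?adde0 //.
apply/eqP; rewrite -measure_le0 -F0; apply: le_measure; rewrite ?inE //.
- by apply: measurableI => //; exact: measurableC.
- exact: measurableC.
Qed.

Lemma integral_atomic F s (g : measurableTypeR R -> \bar R) :
  uniq s -> F (~` [set` s]) = 0 -> measurable_fun setT g ->
  \int[F]_x g x = \sum_(x <- s) g x * (atom F x)%:E.
Proof.
move=> us F0 mg; have ms := measurable_seq s.
rewrite -(setUv [set` s]) integral_setU //; last 3 first.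
- exact: measurableC.
- by rewrite setUv.
- by rewrite disj_set2E setICr.
rewrite [X in _ + X]null_set_integral // ?adde0; last 2 first.
- exact: measurableC.
- exact: measurable_funTS.
move=> {F0 ms}; elim: s us => [|a s IH] /=.
  by rewrite set_nil integral_set0 big_nil.
move=> /andP[nas us]; rewrite set_cons1 big_cons integral_setU //; last 3 first.
- exact: measurable_seq.
- exact: measurable_funTS.
- rewrite disj_set2E; apply/eqP; rewrite -subset0 => x [-> /=].
  by rewrite (negbTE nas).
rewrite IH //; congr (_ + _).
rewrite (eq_integral (cst (g a))); last by move=> x; rewrite inE => ->.
by rewrite integral_cst // -atomE.
Qed.

(** The integrand of [KL] must be measurable before its integral can be reduced
to a sum over the atoms. *)
Lemma measurable_lne : measurable_fun setT (@lne R).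
Proof.
rewrite (_ : @lne R = fun x => if x <= 0 then -oo else
   if x == +oo then +oo else (ln (fine x))%:E); last first.
  by apply/funext => -[r| |] //=; rewrite ?lee_fin ?leNye.
apply: measurable_fun_ifT => //=; first exact: measurable_fun_lee.
apply: measurable_fun_ifT => //=; first exact: measurable_fun_eqe.
apply/measurable_EFinP; apply: (measurableT_comp (@measurable_ln R)).
exact: fine_measurable.
Qed.

(** Listing exactly the points of positive mass keeps [ln (atom F x)] meaningful
all along the list. *)
Definition atomic_on F s : Prop :=
  [/\ uniq s, {in s, forall x, -1 <= x <= 0}%R,
      {in s, forall x, 0 < atom F x}%R & F (~` [set` s]) = 0].

(** The complement of the support is covered by the countably many null
intervals with rational endpoints. *)
Lemma supp_null F : finite_set (supp F) -> F (~` supp F) = 0.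
Proof.
move=> fs.
have ms : measurable (supp F : set (measurableTypeR R)).
  by have /finite_seqP[s ->] := fs; exact: measurable_seq.
apply/eqP; rewrite -measure_le0.
pose I (u : rat * rat) : set R := [set` `]ratr u.1, ratr u.2[%R].
pose B n : set (measurableTypeR R) :=
  if unpickle n is Some u then (if F (I u) == 0 then I u else set0) else set0.
have mB n : measurable (B n).
  rewrite /B; case: unpickle => [u|]//; case: ifP => // _; exact: measurable_itv.
have NB : F (\bigcup_n B n) = 0.
  apply/negligibleP; first exact: bigcup_measurable.
  apply: negligible_bigcup => n; apply/negligibleP => //.
  rewrite /B; case: unpickle => [u|]; last exact: measure0.
  by case: ifP => [/eqP //|_]; exact: measure0.
rewrite -NB; apply: le_measure; rewrite ?inE //=.
- exact: measurableC.
- exact: bigcup_measurable.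
move=> x /= /existsNP[U /not_implyP[[oU Ux] /negP]].
rewrite lt0e measure_ge0 andbT negbK => /eqP FU.
have [e /= e0 xe] : nbhs x U by exact: open_nbhs_nbhs.
have [p /=] := @rat_in_itvoo R (x - e)%R x ltac:(lra).
rewrite in_itv /= => /andP[p1 p2].
have [q /=] := @rat_in_itvoo R x (x + e)%R ltac:(lra).
rewrite in_itv /= => /andP[q1 q2].
set n := pickle (p, q); have nK : unpickle n = Some (p, q) by exact: pickleK.
exists n; [exact: Logic.I|rewrite /B nK].
have IU : I (p, q) `<=` U.
  move=> y; rewrite /I /= in_itv /= => /andP[y1 y2]; apply: xe.
  by rewrite /ball /= ltr_norml; apply/andP; split; lra.
rewrite ifT; first by rewrite /I /= in_itv /= p2 q1.
rewrite -measure_le0 -FU; apply: le_measure; rewrite ?inE //.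
- exact: measurable_itv.
- exact: open_measurable.
Qed.

Lemma family_atomic_on F : finsupp_family F -> exists s, atomic_on F s.
Proof.
move=> [fs s10].
have F0 := supp_null fs.
have /finite_seqP[s0 sE] := fs.
pose s := undup s0.
have {}sE : supp F = [set` s].
  by rewrite sE; apply/seteqP; split => x /=; rewrite mem_undup.
have us : uniq s by rewrite undup_uniq.
rewrite sE in F0 s10.
exists [seq x <- s | (0 < atom F x)%R]; split.
- by rewrite filter_uniq.
- by move=> x; rewrite mem_filter => /andP[_ /s10]; rewrite /= in_itv.
- by move=> x; rewrite mem_filter => /andP[].
rewrite (measure_atomic us F0); last by apply: measurableC; exact: measurable_seq.
congr _%:E; rewrite big_seq_cond big1 // => x /andP[xs].
rewrite inE /= mem_filter xs andbT => /negP; rewrite -leNgt => h.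
by apply/eqP; rewrite eq_le h atom_ge0.
Qed.

Lemma family_of_null F s : {in s, forall x, -1 <= x <= 0}%R ->
  F (~` [set` s]) = 0 -> finsupp_family F.
Proof.
move=> s10 F0.
have sub : supp F `<=` [set` s].
  move=> x Fx; apply: contrapT => xs.
  have := Fx (~` [set` s]); rewrite F0 ltxx => /(_ _)/notF; apply; split => //.
  apply: closed_openC; apply: compact_closed; first exact: Rhausdorff.
  apply: finite_compact; exact: finite_seq.
split; first by apply: sub_finite_set sub _; exact: finite_seq.
by move=> x /sub /s10; rewrite /= in_itv.
Qed.

Lemma mean_atomic F s : uniq s -> F (~` [set` s]) = 0 ->
  mean F = (\sum_(x <- s) x * atom F x)%:E.
Proof.
move=> us F0; rewrite /mean unlock (integral_atomic us F0) ?sumEFin //.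
by apply/measurable_EFinP; exact: measurable_id.
Qed.

Lemma sum_atom F s : uniq s -> F (~` [set` s]) = 0 ->
  (\sum_(x <- s) atom F x = 1)%R.
Proof.
move=> us F0; have := @probability_setT _ _ _ F.
rewrite (measure_atomic us F0) // => -[<-]; apply: eq_bigl => x.
by rewrite in_setT.
Qed.

Lemma sum_atom_le1 F s : uniq s -> (\sum_(x <- s) atom F x <= 1)%R.
Proof.
move=> us; rewrite -lee_fin -(probability_setT F).
rewrite (_ : (\sum_(x <- s) _)%:E = F (setT `&` [set` s])).
  apply: le_measure; rewrite ?inE //; rewrite setTI; exact: measurable_seq.
rewrite measure_seq //; congr _%:E; by apply: eq_bigl => x; rewrite in_setT.
Qed.

Lemma atom_le1 F x : (atom F x <= 1)%R.
Proof. by have := @sum_atom_le1 F [:: x] isT; rewrite big_seq1. Qed.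

Lemma atom_notin F s x : F (~` [set` s]) = 0 -> x \notin s -> atom F x = 0%R.
Proof.
move=> F0 xs; apply/eqP; rewrite -eqe -atomE -measure_le0 -F0.
apply: le_measure; rewrite ?inE //; last by move=> y ->; exact/negP.
by apply: measurableC; exact: measurable_seq.
Qed.

(** On an atom of [G] the density dF/dG is forced to be the ratio of the masses,
and the atoms of [F] carry all of the integral. *)
Lemma KL_atomic F G s : atomic_on F s -> {in s, forall x, 0 < atom G x}%R ->
  KL F G = (\sum_(x <- s) atom F x * ln (atom F x / atom G x))%:E.
Proof.
move=> [us _ Fpos F0] Gpos.
have dom : F `<< G.
  apply/null_content_dominatesP => A mA GA.
  rewrite (measure_atomic us F0) // big_seq_cond big_pred0 // => x.
  apply/negP => /andP[xs]; rewrite inE => Ax.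
  have := Gpos x xs; rewrite ltNge => /negP; apply.
  rewrite -lee_fin -atomE; apply: (@le_trans _ _ (G A)); last by rewrite GA.
  apply: le_measure; rewrite ?inE //.
  by move=> y ->.
rewrite /KL; case: pselect => // dom'.
have dom2 : charge_of_finite_measure F `<< G by [].
have mf := measurable_int _ (Radon_Nikodym_integrable dom2).
rewrite (integral_atomic us F0); last exact: measurableT_comp measurable_lne mf.
rewrite -sumEFin big_seq [RHS]big_seq; apply: eq_bigr => x xs.
have := Radon_Nikodym_integral dom2 (measurable_set1 x).
rewrite (eq_integral (cst ('d (charge_of_finite_measure F) '/d G x))); last first.
  by move=> y; rewrite inE => ->.
rewrite integral_cst //= atomE atomE.
have := @Radon_Nikodym_fin_num _ (measurableTypeR R) _ _ _ x dom2.
case: (_ x) => // r _; rewrite -EFinM => -[FE].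
have Gx := Gpos x xs; have r0 : (0 < r)%R.
  by have := Fpos x xs; rewrite FE pmulr_lgt0.
by rewrite lne_EFin // FE mulfK ?gt_eqF // -EFinM mulrC.
Qed.

(** An atom of [F] that [G] misses destroys absolute continuity. *)
Lemma KL_pinfty F G x : (0 < atom F x)%R -> atom G x = 0%R -> KL F G = +oo.
Proof.
move=> Fx Gx; rewrite /KL; case: pselect => // /null_content_dominatesP dom.
have := dom [set x] (measurable_set1 x) (etrans (atomE G x) (congr1 EFin Gx)).
by rewrite atomE => -[Fx0]; rewrite Fx0 ltxx in Fx.
Qed.

End Finite_support.
(** * Divergences of finitely supported and empirical laws *)

Section Divergence.
Context {R : realType}.
Local Notation dist := (probability (measurableTypeR R) R).
Implicit Types (F G : dist) (s : seq R).

(** The total mass of the weighted sum is 1, so normalization leaves it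
unchanged; it only serves to obtain a probability. *)
Lemma mixture_law (a : R) F G : (0 <= a <= 1)%R -> exists H : dist,
  forall A, H A = (1 - a)%:E * F A + a%:E * G A.
Proof.
move=> /andP[a0 a1]; have b0 : (0 <= 1 - a)%R by rewrite subr_ge0.
pose mu := measure_add (mscale (NngNum b0) F) (mscale (NngNum a0) G).
have muE A : mu A = (1 - a)%:E * F A + a%:E * G A by rewrite /mu measure_addE.
have muT : mu setT = 1.
  by rewrite muE !probability_setT !mule1 -EFinD subrK.
exists (mnormalize mu F) => A.
transitivity (if (mu setT == 0) || (mu setT == +oo) then F A
  else mu A * (fine (mu setT))^-1%:E); first (rewrite /= /mnormalize; by case: ifP).
rewrite muT onee_eq0 /=; by rewrite invr1 mule1 muE.
Qed.

Lemma mixture (a : R) F G s t : (0 <= a <= 1)%R -> atomic_on F s -> atomic_on G t ->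
  exists H : dist, [/\ finsupp_family H,
    forall x, atom H x = ((1 - a) * atom F x + a * atom G x)%R &
    mean H = (1 - a)%:E * mean F + a%:E * mean G].
Proof.
move=> a01 [us s01 _ F0] [ut t01 _ G0]; have [H HE] := mixture_law F G a01.
have Hatom x : atom H x = ((1 - a) * atom F x + a * atom G x)%R.
  apply/EFin_inj; rewrite [RHS]EFinD [in RHS]EFinM [X in _ = _ + X]EFinM -!atomE. by rewrite HE.
have uu : uniq (undup (s ++ t)) by rewrite undup_uniq.
have sub (r : seq R) : {subset r <= undup (s ++ t)} ->
    (~` [set` undup (s ++ t)] : set R) `<=` ~` [set` r].
  by move=> rs x /= xu xr; apply: xu; exact: rs.
have null (K : dist) (r : seq R) : {subset r <= undup (s ++ t)} ->
    K (~` [set` r]) = 0 -> K (~` [set` undup (s ++ t)]) = 0.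
  move=> /sub rs K0; apply/eqP; rewrite -measure_le0 -K0.
  by apply: le_measure; rewrite ?inE //; exact: measurable_seqC.
have Fu := null F s _ F0; have {}Fu : F (~` [set` undup (s ++ t)]) = 0.
  by apply: Fu => x xs; rewrite mem_undup mem_cat xs.
have Gu := null G t _ G0; have {}Gu : G (~` [set` undup (s ++ t)]) = 0.
  by apply: Gu => x xs; rewrite mem_undup mem_cat xs orbT.
have Hu : H (~` [set` undup (s ++ t)]) = 0 by rewrite HE Fu Gu !mule0 adde0.
exists H; split => //.
  apply: family_of_null Hu => x; rewrite mem_undup mem_cat => /orP[/s01|/t01] //.
rewrite (mean_atomic uu Fu) (mean_atomic uu Gu) (mean_atomic uu Hu) -!EFinM -EFinD.
congr _%:E; rewrite !mulr_sumr -big_split /=; apply: eq_bigr => x _.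
by rewrite Hatom; ring.
Qed.

Lemma ln_ler_sub1 (x : R) : (0 < x -> ln x <= x - 1)%R.
Proof. by move=> x0; have := @le_ln1Dx R (x - 1); rewrite [(1 + _)%R]addrC subrK; apply; lra. Qed.

(** Either the sum formula [KL_atomic] applies or the divergence is infinite. *)
Lemma KL_cases F G s : atomic_on F s ->
  {in s, forall x, 0 < atom G x}%R \/ KL F G = +oo.
Proof.
move=> [us _ Fpos F0].
have [/allP h|/allPn[x xs h]] := boolP (all (fun x => 0 < atom G x)%R s); [by left|right].
rewrite -leNgt in h; apply: (@KL_pinfty _ _ _ x); first exact: Fpos.
by apply/eqP; rewrite eq_le h atom_ge0.
Qed.

(** Gibbs' inequality, from [ln y <= y - 1] at [y = G{x} / F{x}]. *)
Lemma KL_ge0 F G s : atomic_on F s -> 0 <= KL F G.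
Proof.
move=> Fs; have [Gpos|->] := KL_cases G Fs; last exact: leey.
rewrite (KL_atomic Fs Gpos) lee_fin; have [us _ Fpos F0] := Fs.
apply: (@le_trans _ _ (\sum_(x <- s) atom F x - 1)%R).
  by rewrite (sum_atom us F0) subrr.
apply: (@le_trans _ _ (\sum_(x <- s) (atom F x - atom G x))%R).
  by rewrite sumrB lerB // sum_atom_le1.
rewrite big_seq [leRHS]big_seq; apply: ler_sum => x xs.
have fx := Fpos x xs; have gx := Gpos x xs.
have h := @ln_ler_sub1 (atom G x / atom F x) (divr_gt0 gx fx).
have {h} : (atom F x * ln (atom G x / atom F x) <= atom F x * (atom G x / atom F x - 1))%R.
  by rewrite ler_pM2l.
have -> : (atom F x * (atom G x / atom F x - 1) = atom G x - atom F x)%R.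
  by rewrite mulrBr mulr1 mulrCA mulfV ?mulr1 // gt_eqF.
by rewrite !ln_div ?posrE //; lra.
Qed.

Lemma KL_self F s : atomic_on F s -> KL F F = 0.
Proof.
move=> Fs; have [us _ Fpos F0] := Fs.
rewrite (KL_atomic Fs Fpos) big_seq big1 // => x xs.
by rewrite mulfV ?ln1 ?mulr0 // gt_eqF // Fpos.
Qed.

Lemma Dmin_ge0 F s mu : atomic_on F s -> 0 <= Dmin F mu.
Proof. by move=> Fs; apply/ereal_infP => _ [G _ <-]; exact: KL_ge0 Fs. Qed.

Lemma Dmin_le F G mu : finsupp_family G -> mu <= mean G -> Dmin F mu <= KL F G.
Proof. by move=> GA Gmu; apply: ereal_inf_lbound; exists G. Qed.

(** If [H] has at least the fraction [a] of the mass of [G] at every point, passing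
from [G] to [H] raises the divergence by at most [- ln a].  Lower bounds on divergences
are expressed by a real [c] so that the value [+oo] needs no separate
treatment. *)
Lemma KL_dominated F G H s (a c : R) : atomic_on F s -> (0 < a)%R ->
  (forall x, a * atom G x <= atom H x)%R -> c%:E <= KL F H ->
  (c + ln a)%:E <= KL F G.
Proof.
move=> Fs a0 GH; have [us _ Fpos F0] := Fs.
have [Gpos|->] := KL_cases G Fs; last by rewrite leey.
have Hpos : {in s, forall x, 0 < atom H x}%R.
  by move=> x xs; apply: lt_le_trans (GH x); rewrite mulr_gt0 // Gpos.
rewrite (KL_atomic Fs Gpos) (KL_atomic Fs Hpos) !lee_fin => ch.
rewrite -lerBrDr; apply: (le_trans ch).
have -> : (ln a = \sum_(x <- s) atom F x * ln a)%R.
  by rewrite -mulr_suml (sum_atom us F0) mul1r.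
rewrite -sumrB big_seq [leRHS]big_seq; apply: ler_sum => x xs.
rewrite -mulrBr ler_pM2l ?Fpos // !ln_div ?posrE ?Fpos ?Gpos ?Hpos //.
have := GH x; rewrite -ler_ln ?posrE ?mulr_gt0 ?Gpos ?Hpos // lnM ?posrE ?Gpos //.
lra.
Qed.

Definition entropy F s : R := (- \sum_(x <- s) atom F x * ln (atom F x))%R.

Lemma entropy_ge0 F s : (0 <= entropy F s)%R.
Proof.
rewrite /entropy oppr_ge0; apply: sumr_le0 => x _.
by rewrite mulr_ge0_le0 ?atom_ge0 // ln_le0 // atom_le1.
Qed.

(** Write the divergence as minus the entropy plus the cross entropy
[- sum F x ln (G x)].  The summands of the cross entropy are nonnegative, so a
lower bound on the masses suffices there, whatever [G] is; the bounds on both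
sides control the entropy. *)
Lemma KL_stable F F' G s (e c : R) : atomic_on F s -> atomic_on F' s ->
  (0 <= e < 1)%R ->
  {in s, forall x, (1 - e) * atom F x <= atom F' x <= (1 + e) * atom F x}%R ->
  c%:E <= KL F G ->
  ((1 - e) * c + ln (1 - e) - 2 * e * entropy F s)%:E <= KL F' G.
Proof.
move=> Fs Fs' /andP[e0 e1] FF'.
have [us _ Fpos F0] := Fs; have [_ _ Fpos' F0'] := Fs'.
have [Gpos|->] := KL_cases G Fs'; last by rewrite leey.
rewrite (KL_atomic Fs Gpos) (KL_atomic Fs' Gpos) !lee_fin => cF.
have e1' : (0 < 1 - e)%R by lra.
apply: (@le_trans _ _ ((1 - e) * (\sum_(x <- s) atom F x * ln (atom F x / atom G x)) + ln (1 - e) - 2 * e * entropy F s))%R.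
  by rewrite !lerD2r ler_pM2l.
have -> : (ln (1 - e) = \sum_(x <- s) atom F' x * ln (1 - e))%R.
  by rewrite -mulr_suml (sum_atom us F0') mul1r.
rewrite /entropy mulrN opprK !mulr_sumr -!big_split /=.
rewrite big_seq [leRHS]big_seq; apply: ler_sum => x xs.
have f0 := Fpos x xs; have f0' := Fpos' x xs; have g0 := Gpos x xs.
have /andP[h1 h2] := FF' x xs.
rewrite !ln_div ?posrE //.
have l1 : (ln (atom F x) <= 0)%R by rewrite ln_le0 // atom_le1.
have l2 : (ln (atom G x) <= 0)%R by rewrite ln_le0 // atom_le1.
have : (ln (1 - e) + ln (atom F x) <= ln (atom F' x))%R.
  by rewrite -lnM ?posrE // ler_ln ?posrE // mulr_gt0.
move=> l3.
have m1 := mulr_ge0 (ltW f0') (etrans (subr_ge0 _ _) l3).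
have m2 : (0 <= (atom F' x - (1 - e) * atom F x) * - ln (atom G x))%R.
  by rewrite mulr_ge0 // ?subr_ge0 ?oppr_ge0.
have m3 : (0 <= ((1 + e) * atom F x - atom F' x) * - ln (atom F x))%R.
  by rewrite mulr_ge0 // ?subr_ge0 ?oppr_ge0.
lra.
Qed.

Lemma sum_undup_count s (g : R -> R) :
  (\sum_(x <- undup s) (count_mem x s)%:R * g x = \sum_(x <- s) g x)%R.
Proof.
rewrite -[RHS]big_undup_iterop_count /=; apply: eq_bigr => x _.
by rewrite mulr_natl.
Qed.

(** The Dirac masses add up to [size s], which is neither 0 nor infinite, so the
normalization divides by it. *)
Lemma empiricalE s (A : set (measurableTypeR R)) : s != [::] ->
  empirical s A = ((\sum_(x <- s) (x \in A)%:R) / (size s)%:R)%:E.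
Proof.
move=> s0.
pose mu := msum (fun m => \d_(nth 0%R s m : measurableTypeR R)) (size s) : set (measurableTypeR R) -> \bar R.
have muE B : mu B = (\sum_(x <- s) (x \in B)%:R)%:E.
  rewrite /mu /msum (big_nth 0%R) big_mkord -sumEFin.
  by apply: eq_bigr => m _; rewrite /= /dirac indicE.
have muT : mu setT = (size s)%:R%:E.
  rewrite muE; congr _%:E; under eq_bigr do rewrite in_setT.
  by rewrite big_const_seq count_predT iter_addr_0.
transitivity (if (mu setT == 0) || (mu setT == +oo) then \d_(0%R : measurableTypeR R) A
  else mu A * (fine (mu setT))^-1%:E); first (rewrite /empirical /= /mnormalize; by case: ifP).
by rewrite muT eqe pnatr_eq0 size_eq0 (negbTE s0) /= muE.
Qed.

Lemma atom_empirical s x : s != [::] ->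
  atom (empirical s) x = ((count_mem x s)%:R / (size s)%:R)%R.
Proof.
move=> s0; apply/EFin_inj; rewrite -atomE (empiricalE _ s0); congr (_ / _)%:E.
rewrite -sum1_count natr_sum [RHS]big_mkcond /=; apply: eq_bigr => y _.
by rewrite in_set1; case: eqP.
Qed.

Lemma empirical_null s : s != [::] -> empirical s (~` [set` s]) = 0.
Proof.
move=> s0; rewrite empiricalE // big_seq big1 ?mul0r // => x xs.
by rewrite memNset //=.
Qed.

Lemma atomic_on_empirical s : s != [::] -> {in s, forall x, -1 <= x <= 0}%R ->
  atomic_on (empirical s) (undup s).
Proof.
move=> s0 s01; have n0 : (0 < (size s)%:R :> R)%R by rewrite ltr0n lt0n size_eq0.
split; first exact: undup_uniq.
- by move=> x; rewrite mem_undup => /s01.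
- move=> x; rewrite mem_undup => xs; rewrite atom_empirical // divr_gt0 //.
  by rewrite ltr0n -has_count has_pred1.
- rewrite (_ : [set` undup s] = [set` s]) ?empirical_null //.
  by apply/seteqP; split => x /=; rewrite mem_undup.
Qed.

Lemma sum_empirical s (g : R -> R) : s != [::] ->
  (\sum_(x <- undup s) atom (empirical s) x * g x =
   (\sum_(x <- s) g x) / (size s)%:R)%R.
Proof.
move=> s0; rewrite -sum_undup_count mulr_suml; apply: eq_bigr => x _.
by rewrite atom_empirical // mulrAC.
Qed.

Lemma mean_empirical s : s != [::] ->
  mean (empirical s) = ((\sum_(x <- s) x) / (size s)%:R)%:E.
Proof.
move=> s0; rewrite (@mean_atomic _ _ (undup s)) ?undup_uniq //.
  by rewrite -(sum_empirical id s0); congr _%:E; apply: eq_bigr => x _; rewrite mulrC.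
rewrite (_ : [set` undup s] = [set` s]) ?empirical_null //.
by apply/seteqP; split => x /=; rewrite mem_undup.
Qed.

(** Concavity of the logarithm. *)
Lemma KL_mixture F G H s (a : R) : atomic_on F s -> (0 <= a <= 1)%R ->
  {in s, forall x, 0 < atom G x}%R ->
  (forall x, atom H x = (1 - a) * atom G x + a * atom F x)%R ->
  KL F H <= ((1 - a) * \sum_(x <- s) atom F x * ln (atom F x / atom G x))%:E.
Proof.
move=> Fs /andP[a0 a1] Gpos HE; have [us _ Fpos F0] := Fs.
have Hpos : {in s, forall x, 0 < atom H x}%R.
  by move=> x xs; rewrite HE; have := Gpos x xs; have := Fpos x xs; nra.
rewrite (KL_atomic Fs Hpos) lee_fin mulr_sumr big_seq [leRHS]big_seq.
apply: ler_sum => x xs.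
have f := Fpos x xs; have g := Gpos x xs; have h := Hpos x xs.
rewrite mulrCA ler_pM2l //.
have h1 := @ln_ler_sub1 (atom F x / atom H x) (divr_gt0 f h).
have h2 := @ln_ler_sub1 (atom G x / atom H x) (divr_gt0 g h).
have e1 : ((1 - a) * (atom G x / atom H x) + a * (atom F x / atom H x) = 1)%R.
  by rewrite !mulrA -mulrDl -HE mulfV // gt_eqF.
rewrite !ln_div ?posrE // in h1 h2 *.
have m1 : (0 <= (1 - a) * (atom G x / atom H x - 1 - (ln (atom G x) - ln (atom H x))))%R.
  by rewrite mulr_ge0 // subr_ge0.
have m2 : (0 <= a * (atom F x / atom H x - 1 - (ln (atom F x) - ln (atom H x))))%R.
  by rewrite mulr_ge0 // subr_ge0.
move: (atom F x / _)%R (atom G x / _)%R e1 m1 m2 => u v; lra.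
Qed.
End Divergence.
(** * Exponential bounds and drifts *)

Section Drift.
Context {R : realType}.
Implicit Types (s x : seq R) (p g : R -> R).
Local Close Scope ereal_scope.
Local Open Scope ring_scope.

(** [expR y <= 1 / (1 - y)], and the right-hand side is at most the quadratic
polynomial for [y <= 1 / 2]. *)
Lemma expR_quad (y : R) : y <= 1 / 2 -> expR y <= 1 + y + 2 * y ^+ 2.
Proof.
move=> y2; have h := @expR_ge1Dx R (- y).
rewrite -[y]opprK expRN invf_ple ?posrE ?expR_gt0 //; last by nra.
apply: le_trans h; rewrite -[leLHS]mul1r ler_pdivrMr; nra.
Qed.

(** The tangent of [expR] at the barycentre lies below [expR]. *)
Lemma expR_convex (a u w : R) : 0 <= a <= 1 ->
  expR ((1 - a) * u + a * w) <= (1 - a) * expR u + a * expR w.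
Proof.
move=> /andP[a0 a1]; set c := (1 - a) * u + a * w.
have H (z : R) : expR c * (1 + (z - c)) <= expR z.
  have -> : expR z = expR c * expR (z - c) by rewrite -expRD addrC subrK.
  by rewrite ler_pM2l ?expR_gt0 // expR_ge1Dx.
have hu := H u; have hw := H w.
have : (1 - a) * (expR u - expR c * (1 + (u - c))) >= 0 by rewrite mulr_ge0; lra.
have : a * (expR w - expR c * (1 + (w - c))) >= 0 by rewrite mulr_ge0; lra.
have : expR c * ((1 - a) * u + a * w - c) = 0 by rewrite subrr mulr0.
lra.
Qed.

(** With mean [m < 0] and [t = - m / 4], the quadratic bound gives at most
[1 + t m + 2 t ^ 2 = 1 - m ^ 2 / 8]. *)
Lemma chernoff s p (f : R -> R) : {in s, forall a, 0 <= p a} ->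
  \sum_(a <- s) p a = 1 -> {in s, forall a, -1 <= f a <= 1} ->
  \sum_(a <- s) p a * f a < 0 ->
  exists2 t, 0 < t & \sum_(a <- s) p a * expR (t * f a) < 1.
Proof.
move=> p0 p1 f1; set m := \sum_(a <- s) _ => m0.
have m1 : -1 <= m.
  rewrite -p1 -sumrN /m big_seq [leRHS]big_seq; apply: ler_sum => a sa.
  by have := p0 a sa; have /andP[] := f1 a sa; nra.
exists (- m / 4); first by lra.
set t := - m / 4.
apply: (@le_lt_trans _ _ (\sum_(a <- s) (p a + t * (p a * f a) + 2 * t ^+ 2 * p a))).
  rewrite big_seq [leRHS]big_seq; apply: ler_sum => a sa.
  have pa := p0 a sa; have /andP[f2 f3] := f1 a sa.
  have t0 : 0 <= t <= 1 / 4 by rewrite /t; apply/andP; split; lra.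
  have h : expR (t * f a) <= 1 + t * f a + 2 * t ^+ 2.
    apply: le_trans (expR_quad _) _; first by nra.
    rewrite lerD2l ler_pM2l // exprMn ler_piMr ?sqr_ge0 //; nra.
  by have := ler_wpM2l pa h; lra.
rewrite !big_split /= p1 -!mulr_sumr p1 -/m /t; nra.
Qed.

(** [B x] bounds the expected total of the costs [b] incurred from [x] on, when
the sequence is extended by independent letters of law [p]. *)
Definition has_drift s p (b : seq R -> R) : Prop :=
  exists B : seq R -> R, (forall x, 0 <= B x) /\
    forall x, b x + \sum_(a <- s) p a * B (rcons x a) <= B x.

(** The witness is the sum of the geometric series of ratio
[\sum_(a <- s) p a * g a]. *)
Lemma has_drift_prod s p g : {in s, forall a, 0 <= p a} -> (forall a, 0 <= g a) ->
  \sum_(a <- s) p a * g a < 1 -> has_drift s p (fun x => \prod_(a <- x) g a).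
Proof.
move=> p0 g0; set r := \sum_(a <- s) _ => r1.
exists (fun x => (\prod_(a <- x) g a) / (1 - r)); split=> [x|x].
  by apply: divr_ge0; [apply: prodr_ge0 | lra].
have -> : \sum_(a <- s) p a * (\prod_(a0 <- rcons x a) g a0 / (1 - r)) =
    r * (\prod_(a <- x) g a / (1 - r)).
  rewrite /r mulr_suml; apply: eq_bigr => a _.
  by rewrite -cats1 big_cat big_seq1 /=; ring.
rewrite le_eqVlt; apply/orP; left; apply/eqP; field.
by rewrite subr_eq0 gt_eqF.
Qed.

Lemma has_drift0 s p : has_drift s p (fun=> 0).
Proof. by exists (fun=> 0); split=> // x; rewrite big1 ?addr0 // => a _; rewrite mulr0. Qed.

Lemma has_drift_add s p b1 b2 : has_drift s p b1 -> has_drift s p b2 ->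
  has_drift s p (fun x => b1 x + b2 x).
Proof.
move=> [B1 [B10 h1]] [B2 [B20 h2]]; exists (fun x => B1 x + B2 x).
split=> x; first by rewrite addr_ge0.
under eq_bigr do rewrite mulrDr.
by rewrite big_split /= addrACA lerD.
Qed.

Lemma has_drift_sum (I : Type) (r : seq I) (P : pred I) s p (b : I -> seq R -> R) :
  (forall i, P i -> has_drift s p (b i)) ->
  has_drift s p (fun x => \sum_(i <- r | P i) b i x).
Proof.
move=> h; elim: r => [|i r IH].
  rewrite [X in has_drift _ _ X](_ : _ = fun=> 0); first exact: has_drift0.
  by apply/funext => x; rewrite big_nil.
rewrite [X in has_drift _ _ X](_ : _ =
    fun x => (if P i then b i x else 0) + \sum_(j <- r | P j) b j x).
  apply: (@has_drift_add _ _ (fun x => if P i then b i x else 0)) IH.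
  by case Pi: (P i); [exact: h | exact: has_drift0].
by apply/funext => x; rewrite big_cons; case: ifP => // _; rewrite add0r.
Qed.

Local Notation dist := (probability (measurableTypeR R) R).

(** The tolerance is relative to the mass of each atom: this is the form of
closeness that [KL_stable] uses. *)
Definition freq_close (F : dist) s (e : R) x : Prop :=
  {in s, forall a, (1 - e) * atom F a <= atom (empirical x) a <= (1 + e) * atom F a}.

(** A relative lower bound on the frequencies forces every atom to be observed. *)
Lemma atomic_on_freq_close (F : dist) s e x : atomic_on F s -> e < 1 -> x != [::] ->
  {subset x <= s} -> freq_close F s e x -> atomic_on (empirical x) s.
Proof.
move=> [us s01 Fpos F0] e1 x0 xs cl; split => //.
  move=> a sa; have /andP[h _] := cl a sa; apply: lt_le_trans h.
  by rewrite mulr_gt0 ?subr_gt0 // Fpos.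
apply/eqP; rewrite -measure_le0 -(empirical_null x0).
apply: le_measure; rewrite ?inE; try exact: measurable_seqC.
by move=> a /= na xa; apply: na; exact: xs.
Qed.

(** Chernoff for the variable [k * [x == a] + c], whose empirical mean is
[k * atom (empirical x) a + c] and whose mean is negative. *)
Lemma count_drift (F : dist) s a (k c : R) : atomic_on F s -> a \in s ->
  `|k| <= 1 -> `|c| <= 1 -> `|k + c| <= 1 ->  k * atom F a + c < 0 ->
  exists b : seq R -> R, [/\ forall x, 0 <= b x, has_drift s (atom F) b &
    forall x, x != [::] -> 0 <= k * atom (empirical x) a + c -> 1 <= b x].
Proof.
move=> Fs sa k1 c1 kc1 neg; have [us s01 Fpos F0] := Fs.
pose f (y : R) : R := k * (y == a)%:R + c.
have f1 : {in s, forall y, -1 <= f y <= 1}.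
  move=> y _; rewrite /f -ler_norml; case: eqP => _; rewrite ?mulr1 //.
  by rewrite mulr0 add0r.
have p0 : {in s, forall y, 0 <= atom F y} by move=> y _; rewrite atom_ge0.
have fneg : \sum_(y <- s) atom F y * f y < 0.
  rewrite /f; under eq_bigr do rewrite mulrDr mulrCA.
  rewrite big_split /= -mulr_suml (sum_atom us F0) mul1r -mulr_sumr.
  rewrite (bigD1_seq a) //= eqxx mulr1 big1 ?addr0 // => y /negbTE ->.
  by rewrite mulr0.
have [t t0 ht] := chernoff p0 (sum_atom us F0) f1 fneg.
exists (fun x => \prod_(y <- x) expR (t * f y)); split.
- by move=> x; apply: prodr_ge0 => y _; exact: expR_ge0.
- apply: has_drift_prod ht => [y _|y]; [exact: atom_ge0|exact: expR_ge0].
- move=> x x0 h; rewrite -expR_sum -mulr_sumr -expR0 ler_expR.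
  apply: mulr_ge0; first exact: ltW.
  rewrite /f big_split /= -mulr_sumr.
  rewrite big_const_seq count_predT iter_addr_0.
  rewrite (_ : \sum_(i <- x) (i == a)%:R = (count_mem a x)%:R); last first.
    rewrite -sum1_count natr_sum [RHS]big_mkcond /=; apply: eq_bigr => y _.
    by case: (y == a).
  have n0 : 0 < (size x)%:R :> R by rewrite ltr0n lt0n size_eq0.
  have := mulr_ge0 h (ltW n0); rewrite atom_empirical // mulrDl.
  by rewrite -mulrA divfK ?gt_eqF // -[c *+ _]mulr_natr.
Qed.

(** A union bound, over the atoms and over the two sides, of the deviations
treated by [count_drift]. *)
Lemma not_close_drift (F : dist) s (e : R) : atomic_on F s -> 0 < e <= 1 ->
  exists b : seq R -> R, [/\ forall x, 0 <= b x, has_drift s (atom F) b &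
    forall x, x != [::] -> ~ freq_close F s e x -> 1 <= b x].
Proof.
move=> Fs /andP[e0 e1]; have [us s01 Fpos F0] := Fs.
have H a : exists b : seq R -> R, a \in s -> [/\ forall x, 0 <= b x, has_drift s (atom F) b &
    forall x, x != [::] -> ~ ((1 - e) * atom F a <= atom (empirical x) a <= (1 + e) * atom F a) -> 1 <= b x].
  have [sa|] := boolP (a \in s); last by exists (fun=> 0).
  have q0 := Fpos a sa; have q1 := atom_le1 F a.
  (* the factor 1 / 2 keeps the variable in [-1, 1] *)
  have [||||b1 [b10 d1 h1]] := @count_drift F s a (1 / 2) (- ((1 + e) * atom F a) / 2) Fs sa.
  - by rewrite ler_norml; apply/andP; split; lra.
  - by rewrite ler_norml; apply/andP; split; nra.
  - by rewrite ler_norml; apply/andP; split; nra.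
  - nra.
  have [||||b2 [b20 d2 h2]] := @count_drift F s a (-1) ((1 - e) * atom F a) Fs sa.
  - by rewrite normrN1.
  - by rewrite ler_norml; apply/andP; split; nra.
  - by rewrite ler_norml; apply/andP; split; nra.
  - nra.
  exists (fun x => b1 x + b2 x) => _; split.
  - by move=> x; rewrite addr_ge0.
  - exact: has_drift_add.
  move=> x x0 /negP; rewrite negb_and -!ltNge => /orP[lo|hi].
    by rewrite -[leLHS]add0r lerD // h2 //; lra.
  rewrite -[leLHS]addr0 lerD // h1 //; nra.
have [b hb] := choice H.
exists (fun x => \sum_(a <- s) b a x); split.
- move=> x; rewrite big_seq sumr_ge0 // => a sa.
  by have [] := hb a sa.
- rewrite [X in has_drift _ _ X](_ : _ = fun x => \sum_(a <- s | a \in s) b a x).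
    by apply: has_drift_sum => a sa; have [] := hb a sa.
  by apply/funext => x; rewrite big_seq.
- move=> x x0 /existsNP[a /not_implyP[sa na]].
  have [b0 _ /(_ x x0 na) b1] := hb a sa.
  rewrite (bigD1_seq a) //= -[leLHS]addr0 lerD // big_seq_cond sumr_ge0 //.
  by move=> a' /andP[sa' _]; have [] := hb a' sa'.
Qed.

(** * A finite cover of the empirical laws *)

Section Grid.
Variables (s : seq R) (M : nat).
Hypothesis M_gt0 : (0 < M)%N.

(** When the entries of [q] add up to at most [M], these are the masses of a
subprobability on [s] in multiples of [1 / M], all shifted by [1 / M]: the shift
makes them positive and raises the total mass only to [1 + size s / M]. *)
Definition grid_value (q : (size s).-tuple 'I_M.+1) (a : R) : R :=
  (nth ord0 q (index a s)).+1%:R / M%:R.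

Lemma grid_value_gt0 q a : 0 < grid_value q a.
Proof. by rewrite divr_gt0 ?ltr0n. Qed.

Lemma sum_grid_value (q : (size s).-tuple 'I_M.+1) : uniq s -> (\sum_(i < size s) tnth q i <= M)%N ->
  \sum_(a <- s) grid_value q a <= 1 + (size s)%:R / M%:R.
Proof.
move=> us qM; rewrite -mulr_suml.
have M0 : 0 < M%:R :> R by rewrite ltr0n.
rewrite ler_pdivrMr // mulrDl divfK ?gt_eqF // mul1r -natrD -natr_sum ler_nat.
rewrite (big_nth 0%R) big_mkord.
under eq_bigr => i _ do rewrite index_uniq // -tnth_nth -addn1.
by rewrite big_split /= leq_add // sum1_card card_ord.
Qed.

(** Rounding the frequencies down to multiples of [1 / M] loses less than [1 / M],
which the shift in [grid_value] gives back. *)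
Lemma grid_cover x : uniq s -> x != [::] -> {subset x <= s} ->
  exists q : (size s).-tuple 'I_M.+1, (\sum_(i < size s) tnth q i <= M)%N /\
    {in s, forall a, atom (empirical x) a <= grid_value q a}.
Proof.
move=> us x0 xs; have n0 : (0 < size x)%N by rewrite lt0n size_eq0.
pose k a := (M * count_mem a x %/ size x)%N.
have kM a : (k a < M.+1)%N.
  by rewrite ltnS -[leqRHS](mulnK _ n0) leq_div2r // leq_mul2l count_size orbT.
pose q := [tuple inord (k (nth 0 s i)) : 'I_M.+1 | i < size s].
exists q; split.
  under eq_bigr => i _ do rewrite tnth_mktuple inordK //.
  rewrite -(leq_pmul2r n0) big_distrl /=.
  apply: (@leq_trans (\sum_(i < size s) M * count_mem (nth 0%R s i) x)%N).
    by apply: leq_sum => i _; exact: leq_trunc_div.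
  rewrite -big_distrr leq_mul2l; apply/orP; right.
  rewrite -(big_mkord xpredT (fun i => count_mem (nth 0%R s i) x)).
  rewrite -(big_nth 0%R xpredT (fun a => count_mem a x)).
  under eq_bigr do rewrite -sum1_count big_mkcond.
  rewrite exchange_big /= -sum1_size big_seq [leqRHS]big_seq.
  apply: leq_sum => y yx; rewrite -big_mkcond sum1_count.
  by rewrite (eq_count (a2 := pred1 y)) ?count_uniq_mem ?leq_b1 // => z; rewrite /= eq_sym.
move=> a sa; rewrite atom_empirical // /grid_value.
have ia : (index a s < size s)%N by rewrite index_mem.
rewrite -[nth _ _ _](tnth_nth _ q (Ordinal ia)) tnth_mktuple /= nth_index // inordK //.
rewrite ler_pdivrMr ?ltr0n // mulrAC ler_pdivlMr ?ltr0n // -!natrM ler_nat mulnC.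
by rewrite ltnW // ltn_ceil.
Qed.
End Grid.

(** The left-hand side is [expR] of [(1 - d) * size x] times the divergence of the
empirical law from [F].  It is dominated by the product over the letters of
[(g / F) ^ (1 - d)] for some [g] in the grid, and the condition on the mean
allows a further factor [expR (d * t * f a)] per letter, [f a] being centred at
the threshold [m].  By convexity of [expR], the one-step mean of the factors is
at most [(1 - d)] times the mass of [g] plus [d * r], where [r < 1] is the
Chernoff factor of [f]; a fine grid makes this smaller than 1. *)
Lemma low_mean_drift (F : dist) s (m d : R) : atomic_on F s -> 0 < d < 1 ->
  -2 <= m <= 0 -> m < \sum_(a <- s) atom F a * a ->
  exists v : seq R -> R, [/\ forall x, 0 <= v x, has_drift s (atom F) v &
    forall x, x != [::] -> {subset x <= s} -> \sum_(a <- x) a <= m * (size x)%:R ->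
      expR ((1 - d) * \sum_(a <- x) ln (atom (empirical x) a / atom F a)) <= v x].
Proof.
move=> Fs /andP[d0 d1] /andP[m2 m0] mF; have [us s01 Fpos F0] := Fs.
(* [m - a] ranges over [-2, 1]; halving it fits the range of [chernoff] *)
pose f (a : R) : R := (m - a) / 2.
have f1 : {in s, forall a, -1 <= f a <= 1}.
  by move=> a /s01; rewrite /f => /andP[a1 a0]; apply/andP; split; lra.
have p0 : {in s, forall y, 0 <= atom F y} by move=> y _; rewrite atom_ge0.
have fneg : \sum_(y <- s) atom F y * f y < 0.
  rewrite /f; under eq_bigr do rewrite mulrA mulrBr.
  rewrite -mulr_suml sumrB -mulr_suml (sum_atom us F0); lra.
have [t t0 ht] := chernoff p0 (sum_atom us F0) f1 fneg.
set r := \sum_(a <- s) _ in ht.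
have dr : 0 < d * (1 - r) by rewrite mulr_gt0 // subr_gt0.
(* fine enough for (1 - d) * (1 + size s / M) + d * r < 1 *)
pose M := (Num.truncn ((size s)%:R / (d * (1 - r)) : R)).+1.
have M0 : 0 < M%:R :> R by rewrite ltr0n.
have Mn : (size s)%:R / M%:R < d * (1 - r).
  rewrite ltr_pdivrMr // mulrC -ltr_pdivrMr //; exact: truncnS_gt.
pose h (q : (size s).-tuple 'I_M.+1) (a : R) : R :=
  expR ((1 - d) * ln (grid_value q a / atom F a) + d * (t * f a)).
pose ok (q : (size s).-tuple 'I_M.+1) := (\sum_(i < size s) tnth q i <= M)%N.
exists (fun x => \sum_(q | ok q) \prod_(a <- x) h q a); split.
- move=> x; apply: sumr_ge0 => q _; apply: prodr_ge0 => a _; exact: expR_ge0.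
- apply: has_drift_sum => q okq; apply: has_drift_prod => // [a|].
    exact: expR_ge0.
  apply: (@le_lt_trans _ _ (\sum_(a <- s) ((1 - d) * grid_value q a + d * (atom F a * expR (t * f a))))).
    rewrite big_seq [leRHS]big_seq; apply: ler_sum => a sa.
    have Fa := Fpos a sa; have ga := grid_value_gt0 (isT : (0 < M)%N) q a.
    have d01 : 0 <= d <= 1 by rewrite !ltW.
    have := expR_convex (ln (grid_value q a / atom F a)) (t * f a) d01.
    rewrite lnK ?posrE ?divr_gt0 // -/(h q a) => hle.
    rewrite -(ler_pM2l Fa) in hle.
    apply: (le_trans hle); rewrite le_eqVlt; apply/orP; left; apply/eqP.
    by field; rewrite gt_eqF.
  rewrite big_split /= -!mulr_sumr -/r.
  have S := sum_grid_value (isT : (0 < M)%N) us okq.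
  have : (1 - d) * \sum_(a <- s) grid_value q a <= (1 - d) * (1 + (size s)%:R / M%:R).
    by rewrite ler_wpM2l // subr_ge0 ltW.
  have n0 : 0 <= (size s)%:R / M%:R :> R by rewrite divr_ge0.
  move: ((size s)%:R / M%:R) n0 Mn => w n0 Mn; nra.
- move=> x x0 xs xm; have [q [okq hq]] := grid_cover (isT : (0 < M)%N) us x0 xs.
  rewrite (bigD1 q) //= -[leLHS]addr0 lerD //; last first.
    apply: sumr_ge0 => q' _; apply: prodr_ge0 => a _; exact: expR_ge0.
  rewrite /h -expR_sum ler_expR big_split /= -!mulr_sumr -[leLHS]addr0 lerD //.
    apply: ler_wpM2l; first by rewrite subr_ge0 ltW.
    rewrite big_seq [leRHS]big_seq.
    apply: ler_sum => a ax; have sa := xs a ax.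
    have Fa := Fpos a sa; have ga := grid_value_gt0 (isT : (0 < M)%N) q a.
    have ea : 0 < atom (empirical x) a.
      rewrite atom_empirical // divr_gt0 ?ltr0n //; first by rewrite -has_count has_pred1.
      by rewrite lt0n size_eq0.
    rewrite ler_ln ?posrE ?divr_gt0 // ler_pM2r ?invr_gt0 //; exact: hq.
  apply: mulr_ge0; first exact: ltW; apply: mulr_ge0; first exact: ltW.
  rewrite /f -mulr_suml divr_ge0 // sumrB big_const_seq count_predT iter_addr_0.
  by rewrite -mulr_natr subr_ge0.
Qed.

End Drift.
(** * Potential argument for a bandit run *)

Section Run.
Context {R : realType} (K : nat).
Local Notation dist := (probability (measurableTypeR R) R).
Local Notation history := (history (R := R) K).
Context (F : 'I_K -> dist) (S : 'I_K -> seq R) (pi : policy (R := R) K).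
Hypothesis FS : forall k, atomic_on (F k) (S k).
Context {d : measure_display} {Omega : measurableType d}.
Context {P : probability Omega R}.
Variables (J : nat -> Omega -> 'I_K) (X : nat -> {RV P >-> R}).
Hypothesis run : bandit_run J X F pi.

Definition outcomes : seq ('I_K * R) := [seq (k, a) | k <- enum 'I_K, a <- S k].

(** Up to a null event, only these finitely many histories occur. *)
Fixpoint histories (n : nat) : seq history :=
  if n is n'.+1 then [seq rcons h z | h <- histories n', z <- outcomes] else [:: [::]].

Definition hist_prob n (h : history) : R := fine (P [set w | history_after J X n w = h]).

Definition hist_mean n (g : history -> R) : R :=
  (\sum_(h <- histories n) hist_prob n h * g h)%R.

Lemma size_histories n h : h \in histories n -> size h = n.
Proof.
elim: n h => [|n IH] h /=; first by rewrite inE => /eqP ->.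
by move=> /allpairsP[[h' z] /= [h'n _ ->]]; rewrite size_rcons (IH h').
Qed.

Lemma mem_outcomes k a : ((k, a) \in outcomes) = (a \in S k).
Proof.
apply/allpairsPdep/idP => [[k' [a' [_ h [-> ->]]]] //|h].
by exists k, a; rewrite mem_enum.
Qed.

Lemma histories_support n h z : h \in histories n -> z \in h -> z.2 \in S z.1.
Proof.
elim: n h => [|n IH] h /=; first by rewrite inE => /eqP ->.
move=> /allpairsP[[h' [k a]] /= [h'n + ->]]; rewrite mem_outcomes => aS.
by rewrite mem_rcons inE => /orP[/eqP -> //|]; exact: IH.
Qed.

Lemma uniq_outcomes : uniq outcomes.
Proof.
apply: allpairs_uniq_dep; first exact: enum_uniq.
- by move=> k _; have [] := FS k.
- by move=> [k a] [k' a'] /= _ _ [-> ->].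
Qed.

Lemma uniq_histories n : uniq (histories n).
Proof.
elim: n => [//|n IH] /=; apply: allpairs_uniq => //; first exact: uniq_outcomes.
by move=> [h z] [h' z'] _ _ /= /rcons_inj[-> ->].
Qed.

Lemma history_afterS n w :
  history_after J X n.+1 w = rcons (history_after J X n w) (J n w, X n w).
Proof. by rewrite /history_after -addn1 iotaD map_cat cats1. Qed.

Lemma history_afterSE n h k a :
  [set w | history_after J X n.+1 w = rcons h (k, a)] =
  [set w | [/\ history_after J X n w = h, J n w = k & [set a] (X n w)]].
Proof.
apply/seteqP; split => w /=; rewrite history_afterS.
  by move=> /rcons_inj[-> -> ->].
by move=> [-> -> ->].
Qed.

Lemma measurable_arm n k : measurable [set w | J n w = k].
Proof. exact: arm_measurable run n k. Qed.

Lemma measurable_history n h : measurable [set w | history_after J X n w = h].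
Proof.
elim: n h => [|n IH] h.
  have [->|h0] := eqVneq h [::].
    by rewrite (_ : mkset _ = setT) //; apply/seteqP; split.
  rewrite (_ : mkset _ = set0) //; apply/seteqP; split => // w /= wh.
  by rewrite -wh eqxx in h0.
case: (lastP h) => [|h' [k a]].
  by rewrite (_ : mkset _ = set0) //; apply/seteqP; split.
rewrite history_afterSE (_ : mkset _ = [set w | history_after J X n w = h'] `&`
  [set w | J n w = k] `&` (X n @^-1` [set a])); last first.
  by apply/seteqP; split => w /= [] => [? ? ?|[? ?] ?].
apply: measurableI; first by apply: measurableI => //; exact: measurable_arm.
by rewrite -[X in measurable X]setTI; exact: measurable_funPT.
Qed.

Lemma hist_probE n h : P [set w | history_after J X n w = h] = (hist_prob n h)%:E.
Proof. by rewrite /hist_prob fineK // fin_num_measure //; exact: measurable_history. Qed.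

Lemma hist_prob_ge0 n h : (0 <= hist_prob n h)%R.
Proof. by rewrite /hist_prob fine_ge0. Qed.

Lemma hist_prob0 : hist_prob 0 [::] = 1%R.
Proof.
rewrite /hist_prob (_ : mkset _ = setT) ?probability_setT //.
by apply/seteqP; split.
Qed.

Lemma hist_probS n h k a :
  hist_prob n.+1 (rcons h (k, a)) = (hist_prob n h * pi h k * atom (F k) a)%R.
Proof.
apply: EFin_inj; rewrite -hist_probE history_afterSE.
rewrite (reward_law run) // (arm_law run) hist_probE.
by rewrite (_ : F k [set a] = (atom (F k) a)%:E) ?atomE.
Qed.

Lemma hist_mean0 g : hist_mean 0 g = g [::].
Proof. by rewrite /hist_mean /= big_seq1 hist_prob0 mul1r. Qed.

(** The conditional mean of [g] after one more round, given the history [h]. *)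
Definition next_mean (g : history -> R) (h : history) : R :=
  (\sum_(k < K) pi h k * \sum_(a <- S k) atom (F k) a * g (rcons h (k, a)))%R.

Lemma hist_meanS n g : hist_mean n.+1 g = hist_mean n (next_mean g).
Proof.
rewrite /hist_mean /= big_allpairs_dep; apply: eq_bigr => h _.
rewrite /outcomes big_allpairs_dep /= big_enum /next_mean mulr_sumr.
apply: eq_bigr => k _; rewrite mulrA mulr_sumr; apply: eq_bigr => a _.
by rewrite hist_probS; ring.
Qed.

Hypothesis pi_sum1 : forall n h, h \in histories n -> (0 < hist_prob n h)%R ->
  (\sum_(k < K) pi h k = 1)%R.

Lemma hist_mean1 n : hist_mean n (fun=> 1%R) = 1%R.
Proof.
elim: n => [|n IH]; first by rewrite hist_mean0.
rewrite hist_meanS; transitivity (hist_mean n (fun=> 1%R)); last exact: IH.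
rewrite /hist_mean big_seq [RHS]big_seq.
apply: eq_bigr => h hn; have := hist_prob_ge0 n h.
rewrite le_eqVlt => /orP[/eqP <-|h0]; first by rewrite !mul0r.
congr (_ * _)%R; rewrite -[RHS](pi_sum1 hn h0).
apply: eq_bigr => k _; under eq_bigr do rewrite mulr1.
by have [us _ _ F0] := FS k; rewrite (sum_atom us F0) mulr1.
Qed.

Lemma measurable_histories n (L : seq history) :
  measurable [set w | history_after J X n w \in L].
Proof.
elim: L => [|h' L IH].
  by rewrite (_ : mkset _ = set0) //; apply/seteqP; split.
rewrite (_ : mkset _ = [set w | history_after J X n w = h'] `|`
   [set w | history_after J X n w \in L]).
  by apply: measurableU => //; exact: measurable_history.
apply/seteqP; split => w /=; rewrite in_cons; first by move=> /orP[/eqP|]; [left|right].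
by move=> [->|->]; rewrite ?eqxx ?orbT.
Qed.

Lemma measure_histories n (A : set Omega) (L : seq history) : uniq L -> measurable A ->
  P (A `&` [set w | history_after J X n w \in L]) =
  \sum_(h <- L) P (A `&` [set w | history_after J X n w = h]).
Proof.
move=> + mA; elim: L => [|h L IH] /=.
  by rewrite big_nil (_ : _ `&` _ = set0) ?measure0 // -subset0 => w [].
move=> /andP[hL uL]; rewrite big_cons -IH // -measureU.
- congr (P _); apply/seteqP; split => w /=.
    by rewrite inE => -[Aw /orP[/eqP|]]; [left|right].
  by rewrite inE => -[[Aw ->]|[Aw ->]]; rewrite ?eqxx ?orbT.
- by apply: measurableI => //; exact: measurable_history.
- by apply: measurableI => //; exact: measurable_histories.
- rewrite -subset0 => w [[_ /= ->] [_ /=]]; by rewrite (negbTE hL).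
Qed.

(** The listed histories have total probability 1 by [hist_mean1], so the other
ones contribute nothing. *)
Lemma arm_prob_le n k : P [set w | J n w = k] <= (hist_mean n (fun h => pi h k))%:E.
Proof.
pose U := [set w | history_after J X n w \in histories n].
have un := uniq_histories n.
have PU : P (setT `&` U) = 1.
  rewrite measure_histories // -[RHS]/(1%:E) -[in RHS](hist_mean1 n) /hist_mean -sumEFin.
  by apply: eq_bigr => h _; rewrite setTI mulr1 hist_probE.
rewrite setTI in PU.
have mU : measurable U by exact: measurable_histories.
have mA := measurable_arm n k.
have UC0 : P (~` U) = 0 by rewrite probability_setC // PU subee.
apply: (@le_trans _ _ (P ([set w | J n w = k] `&` U) + P (~` U))).
  have mI := measurableI _ _ mA mU; have mC := measurableC mU.
  apply: le_trans (measureU2 _ mI mC); apply: le_measure; rewrite ?inE //.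
    exact: measurableU.
  by move=> w Aw; case: (pselect (U w)) => Uw; [left|right].
rewrite UC0 adde0 measure_histories // /hist_mean -sumEFin.
apply: lee_sum => h _; rewrite EFinM -hist_probE -(arm_law run).
by rewrite setIC.
Qed.

Lemma expected_pulls i N :
  'E_P[fun w => (pulls J i N w)%:R] = \sum_(n < N) P [set w | J n w = i].
Proof.
rewrite unlock.
under eq_integral do rewrite /pulls natr_sum -sumEFin.
have JE n w : ((J n w == i)%:R)%:E = (\1_[set w | J n w = i] w)%:E :> \bar R.
  rewrite indicE; congr ((nat_of_bool _)%:R)%:E; apply/eqP/idP => [Jw|].
    by rewrite inE.
  by rewrite inE.
rewrite ge0_integral_sum //.
- apply: eq_bigr => n _; under eq_integral do rewrite JE.
  by rewrite integral_indic ?setIT //; exact: measurable_arm.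
- move=> n; under eq_fun do rewrite JE.
  by apply/measurable_EFinP; apply: measurable_indic; exact: measurable_arm.
Qed.

(** Telescoping of the means of [Psi]; the inequality is only required on the
histories that have a positive probability, where the structure of the policy
can be used. *)
Lemma potential_bound (g Psi : history -> R) (c : nat -> R) N :
  (forall h, 0 <= Psi h)%R ->
  (forall n h, h \in histories n -> (0 < hist_prob n h)%R ->
    (g h + next_mean Psi h <= Psi h + c n)%R) ->
  (\sum_(n < N) hist_mean n g <= Psi [::] + \sum_(n < N) c n)%R.
Proof.
move=> Psi0 step.
suff : (\sum_(n < N) hist_mean n g + hist_mean N Psi <= Psi [::] + \sum_(n < N) c n)%R.
  apply: le_trans; rewrite lerDl; apply: sumr_ge0 => h _.
  by rewrite mulr_ge0 // hist_prob_ge0.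
elim: N => [|N IH]; first by rewrite !big_ord0 hist_mean0 add0r addr0.
rewrite !big_ord_recr /= addrA -[leLHS]addrA.
apply: (@le_trans _ _ (\sum_(n < N) hist_mean n g + (hist_mean N Psi + c N))%R); last first.
  by rewrite addrA lerD2r.
rewrite lerD2l hist_meanS -[c N]mulr1 -(hist_mean1 N) /hist_mean mulr_sumr -!big_split /=.
rewrite big_seq [leRHS]big_seq; apply: ler_sum => h hn.
have := hist_prob_ge0 N h; rewrite le_eqVlt => /orP[/eqP <-|h0].
  by rewrite !mul0r mulr0 addr0.
have hs := step N h hn h0; rewrite -(ler_pM2l h0) in hs; lra.
Qed.

Lemma expected_pulls_bound i (Psi : history -> R) (c : nat -> R) N :
  (forall h, 0 <= Psi h)%R ->
  (forall n h, h \in histories n -> (0 < hist_prob n h)%R ->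
    (pi h i + next_mean Psi h <= Psi h + c n)%R) ->
  'E_P[fun w => (pulls J i N w)%:R] <= (Psi [::] + \sum_(n < N) c n)%:E.
Proof.
move=> Psi0 step; rewrite expected_pulls.
apply: (@le_trans _ _ (\sum_(n < N) (hist_mean n (fun h => pi h i))%:E)).
  by apply: lee_sum => n _; exact: arm_prob_le.
rewrite sumEFin lee_fin; exact: potential_bound.
Qed.

Lemma rewards_of_rcons (h : history) k a i :
  rewards_of (rcons h (k, a)) i =
  if k == i then rcons (rewards_of h i) a else rewards_of h i.
Proof. by rewrite /rewards_of filter_rcons /=; case: ifP => // _; rewrite map_rcons. Qed.

(** The rewards of arm [i] change only when that arm is pulled. *)
Lemma next_mean_rewards n h i (phi : seq R -> R) :
  h \in histories n -> (0 < hist_prob n h)%R ->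
  next_mean (fun h => phi (rewards_of h i)) h =
  (phi (rewards_of h i) + pi h i *
    (\sum_(a <- S i) atom (F i) a * phi (rcons (rewards_of h i) a)
     - phi (rewards_of h i)))%R.
Proof.
move=> hn h0; rewrite /next_mean (bigD1 i) //=.
have -> : (\sum_(a <- S i) atom (F i) a * phi (rewards_of (rcons h (i, a)) i) =
    \sum_(a <- S i) atom (F i) a * phi (rcons (rewards_of h i) a))%R.
  by apply: eq_bigr => a _; rewrite rewards_of_rcons eqxx.
have -> : (\sum_(k < K | k != i) pi h k *
    (\sum_(a <- S k) atom (F k) a * phi (rewards_of (rcons h (k, a)) i)) =
    (1 - pi h i) * phi (rewards_of h i))%R.
  have -> : (1 - pi h i = \sum_(k < K | k != i) pi h k)%R.
    by have := pi_sum1 hn h0; rewrite (bigD1 i) //= => <-; ring.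
  rewrite mulr_suml.
  apply: eq_bigr => k ki; congr (_ * _)%R.
  under eq_bigr do rewrite rewards_of_rcons (negbTE ki).
  by have [us _ _ F0] := FS k; rewrite -mulr_suml (sum_atom us F0) mul1r.
ring.
Qed.

Hypothesis pi_ge0 : forall h k, (0 <= pi h k)%R.

Lemma next_mean_drift n h i b B :
  (forall x, b x + \sum_(a <- S i) atom (F i) a * B (rcons x a) <= B x)%R ->
  h \in histories n -> (0 < hist_prob n h)%R ->
  (next_mean (fun h => B (rewards_of h i)) h <=
   B (rewards_of h i) - pi h i * b (rewards_of h i))%R.
Proof.
move=> bB hn h0; rewrite (next_mean_rewards _ _ hn h0) lerD2l -mulrN.
rewrite ler_wpM2l //; have := bB (rewards_of h i); lra.
Qed.

Lemma next_meanD g1 g2 h :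
  next_mean (fun h => g1 h + g2 h)%R h = (next_mean g1 h + next_mean g2 h)%R.
Proof.
rewrite /next_mean -big_split; apply: eq_bigr => k _ /=; rewrite -mulrDr.
by congr (_ * _)%R; rewrite -big_split; apply: eq_bigr => a _; rewrite mulrDr.
Qed.

(** The potential is [(L - T_i) + B (rewards of i) + V (rewards of j)], with
truncated subtraction and [T_i] the number of pulls of [i] so far: each of the
first [L] pulls of arm [i] decreases the first term by 1, and the drifts decrease
the other two by at least the expected costs. *)
Lemma drift_pulls_bound i j b v : has_drift (S i) (atom (F i)) b ->
  has_drift (S j) (atom (F j)) v ->
  exists C : R, forall (L : nat) (c : nat -> R) N,
    (forall n h, h \in histories n -> (0 < hist_prob n h)%R ->
      (pi h i <= c n + pi h i * (size (rewards_of h i) < L)%N%:R +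
        pi h i * b (rewards_of h i) + pi h j * v (rewards_of h j))%R) ->
    'E_P[fun w => (pulls J i N w)%:R] <= (C + L%:R + \sum_(n < N) c n)%:E.
Proof.
move=> [B [B0 bB]] [V [V0 vV]]; exists (B [::] + V [::])%R => L c N H.
pose T (x : seq R) := (L - size x)%N%:R : R.
have tT x : ((size x < L)%N%:R + \sum_(a <- S i) atom (F i) a * T (rcons x a) <= T x)%R.
  under eq_bigr do rewrite /T size_rcons.
  have [us _ _ F0] := FS i.
  rewrite -mulr_suml (sum_atom us F0) mul1r /T -natrD ler_nat.
  by case: (ltnP (size x) L) => xL; rewrite ?add0n ?leq_sub2l // add1n subnSK.
pose Psi (h : history) := (T (rewards_of h i) + B (rewards_of h i) + V (rewards_of h j))%R.
have := @expected_pulls_bound i Psi c N.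
have -> : Psi [::] = (B [::] + V [::] + L%:R)%R.
  by rewrite /Psi /T /= subn0; ring.
apply=> [h|n h hn h0]; first by rewrite /Psi !addr_ge0 // /T.
rewrite /Psi !next_meanD.
have h1 := next_mean_drift tT hn h0; have h2 := next_mean_drift bB hn h0.
have h3 := next_mean_drift vV hn h0; have h4 := H n h hn h0.
lra.
Qed.

End Run.
(** * Weights of the MED policy *)

Section Med.
Context {R : realType} (K : nat).
Local Notation dist := (probability (measurableTypeR R) R).
Local Notation history := (history (R := R) K).
Implicit Types (h : history).

Lemma best_mean_attained (G : 'I_K -> dist) (j : 'I_K) :
  exists k, best_mean G = mean (G k).
Proof.
have [//|i _|k _ kE] := @eq_bigmax _ (\bar R) _ -oo j xpredT (fun k => mean (G k)).
  exact: leNye.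
by exists k.
Qed.

Lemma le_best_mean (G : 'I_K -> dist) k : mean (G k) <= best_mean G.
Proof. exact: (le_bigmax _ (fun k => mean (G k)) k). Qed.

Lemma med_weight_ge0 h k : (0 <= med_weight h k)%R.
Proof. by rewrite /med_weight fine_ge0 // expeR_ge0. Qed.

Lemma med_policy_ge0 h k : (0 <= med_policy K h k)%R.
Proof.
rewrite /med_policy; case: ifP => // _.
by rewrite divr_ge0 ?med_weight_ge0 // sumr_ge0 // => l _; exact: med_weight_ge0.
Qed.

Lemma med_weight_le h k (c : R) : rewards_of h k != [::] ->
  0 <= med_divergence h k -> c%:E <= med_divergence h k ->
  (med_weight h k <= expR (- ((size (rewards_of h k))%:R * c)))%R.
Proof.
rewrite -size_eq0 -lt0n /med_weight => n0; case: (med_divergence h k) => [D| |] //=.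
  rewrite !lee_fin => _ cD /=.
  by rewrite ler_expR lerN2 ler_wpM2l.
by rewrite gt0_muley ?lte_fin ?ltr0n //= expR_ge0.
Qed.

Lemma med_weight_infty h k : rewards_of h k != [::] ->
  med_divergence h k = +oo -> med_weight h k = 0%R.
Proof.
rewrite -size_eq0 -lt0n /med_weight => n0 ->.
by rewrite gt0_muley ?lte_fin ?ltr0n.
Qed.

Lemma med_weight_ge h k (c : R) :
  0 <= med_divergence h k -> med_divergence h k <= c%:E ->
  (expR (- ((size (rewards_of h k))%:R * c)) <= med_weight h k)%R.
Proof.
rewrite /med_weight; case: (med_divergence h k) => [D| |] //=.
by rewrite !lee_fin => _ cD /=; rewrite ler_expR lerN2 ler_wpM2l.
Qed.

Definition explored h : Prop :=
  forall k, rewards_of h k != [::] /\ {in rewards_of h k, forall a, -1 <= a <= 0}%R.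

Lemma atomic_on_explored h k : explored h -> atomic_on (empirical_dist h k) (undup (rewards_of h k)).
Proof. by move=> /(_ k)[h0 h1]; exact: atomic_on_empirical. Qed.

Lemma atomic_on_family (F : dist) s : atomic_on F s -> finsupp_family F.
Proof. by move=> [us s01 _ F0]; exact: family_of_null F0. Qed.

Lemma med_divergence_ge0 h k : explored h -> 0 <= med_divergence h k.
Proof. by move=> /(atomic_on_explored k)/Dmin_ge0; exact. Qed.

Lemma med_weight_le1 h k : explored h -> (med_weight h k <= 1)%R.
Proof.
move=> hx; have D0 := med_divergence_ge0 k hx.
have := med_weight_le (hx k).1 D0 D0; by rewrite mulr0 oppr0 expR0.
Qed.

(** The arm that attains the largest empirical mean has divergence 0, hence weight
1; no weight exceeds 1. *)
Lemma med_weight_sum h (j : 'I_K) : explored h ->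
  (1 <= \sum_(l < K) med_weight h l <= K%:R)%R.
Proof.
move=> hx; apply/andP; split.
  have [k kE] := best_mean_attained (empirical_dist h) j.
  have D0 : med_divergence h k <= 0.
    rewrite /med_divergence -(KL_self (atomic_on_explored k hx)) kE.
    by apply: Dmin_le => //; exact: atomic_on_family (atomic_on_explored k hx).
  have := med_weight_ge (med_divergence_ge0 k hx) D0.
  rewrite mulr0 oppr0 expR0 (bigD1 k) //= => h1.
  rewrite -[leLHS]addr0 lerD // sumr_ge0 // => l _; exact: med_weight_ge0.
rewrite -[leRHS](_ : \sum_(l < K) 1 = _)%R; last by rewrite sumr_const card_ord.
by apply: ler_sum => l _; exact: med_weight_le1.
Qed.

Lemma med_policy_late h k : explored h -> (K <= size h)%N ->
  [/\ med_policy K h k <= 1, med_policy K h k <= med_weight h k &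
      med_weight h k / K%:R <= med_policy K h k]%R.
Proof.
move=> hx Kh; rewrite /med_policy ltnNge Kh /=.
have /andP[s1 sK] := med_weight_sum k hx.
have w0 := med_weight_ge0 h k; have w1 := med_weight_le1 k hx.
have s0 : (0 < \sum_(l < K) med_weight h l)%R by apply: lt_le_trans s1.
have K0 : (0 < K%:R :> R)%R by apply: lt_le_trans sK.
have le : (med_weight h k / \sum_(l < K) med_weight h l <= med_weight h k)%R.
  by rewrite ler_pdivrMr // ler_peMr.
split => //; first exact: le_trans w1.
by rewrite ler_wpM2l // lef_pV2.
Qed.

Lemma med_policy_sum1 h (j : 'I_K) : ((K <= size h)%N -> explored h) ->
  (\sum_(k < K) med_policy K h k = 1)%R.
Proof.
move=> hx; rewrite /med_policy; case: ltnP => [hK|Kh].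
  rewrite (bigD1 (Ordinal hK)) //= eqxx big1 ?addr0 // => k kh.
  by rewrite (_ : (nat_of_ord k == size h) = false) //; apply/negbTE.
have /andP[s1 _] := med_weight_sum j (hx Kh).
by rewrite -mulr_suml mulfV // gt_eqF //; apply: lt_le_trans s1.
Qed.

End Med.
(** * Runs of the MED policy *)

Section Run_of_med.
Context {R : realType} (K : nat).
Local Notation dist := (probability (measurableTypeR R) R).
Local Notation history := (history (R := R) K).
Implicit Types (h : history).
Context (F : 'I_K -> dist) (S : 'I_K -> seq R).
Hypothesis FS : forall k, atomic_on (F k) (S k).
Context {d : measure_display} {Omega : measurableType d}.
Context {P : probability Omega R}.
Variables (J : nat -> Omega -> 'I_K) (X : nat -> {RV P >-> R}).
Hypothesis run : bandit_run J X F (med_policy K).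

(** In the initial rounds the policy gives probability 0 to every arm but the
scheduled one, so no history of positive probability deviates from the
schedule. *)
Lemma pulled_once n h (k : 'I_K) : h \in histories S n -> (0 < hist_prob J X n h)%R ->
  (k < n)%N -> rewards_of h k != [::].
Proof.
elim: n h => [//|n IH] h /= /allpairsP[[h' [k' a]] /= [h'n _ ->]].
rewrite (hist_probS run) rewards_of_rcons => p0 kn.
have p0' : (0 < hist_prob J X n h')%R.
  rewrite lt0r hist_prob_ge0 andbT; apply: contraTneq p0 => ->.
  by rewrite !mul0r ltxx.
have pi0 : med_policy K h' k' != 0%R.
  by apply: contraTneq p0 => ->; rewrite mulr0 mul0r ltxx.
case: (ltnP k n) => [kn'|nk].
  have := IH h' h'n p0' kn'; case: ifP => // _ _.
  by rewrite -size_eq0 size_rcons.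
have {nk} kE : nat_of_ord k = n by apply/eqP; rewrite eqn_leq -ltnS kn.
move: pi0; rewrite /med_policy (size_histories h'n) -kE ltn_ord.
case: (k' =P k) => [_ _|kk']; first by rewrite -size_eq0 size_rcons.
by rewrite (_ : (nat_of_ord k' == k) = false) ?eqxx //; apply/eqP => /val_inj.
Qed.

Lemma rewards_support n h k : h \in histories S n -> {subset rewards_of h k <= S k}.
Proof.
move=> hn a /mapP[z]; rewrite mem_filter => /andP[/eqP <- zh] ->.
exact: histories_support hn zh.
Qed.

Lemma explored_histories n h : h \in histories S n -> (0 < hist_prob J X n h)%R ->
  (K <= n)%N -> explored h.
Proof.
move=> hn h0 Kn k; split.
  by apply: (pulled_once hn h0); apply: leq_trans Kn.
by move=> a /(rewards_support hn); have [_ s01 _ _] := FS k => /s01.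
Qed.

(** Each of the [K] initial rounds is charged a full pull; this accounts for the
[K] in the constant. *)
Lemma med_pulls_bound i j b v :
  (forall x, 0 <= b x)%R -> (forall x, 0 <= v x)%R ->
  has_drift (S i) (atom (F i)) b -> has_drift (S j) (atom (F j)) v ->
  exists C : R, forall (L : nat) (c : R) N, (0 <= c)%R ->
    (forall h, explored h -> (K <= size h)%N ->
      (forall k, {subset rewards_of h k <= S k}) ->
      (med_policy K h i <= c + med_policy K h i * (size (rewards_of h i) < L)%N%:R +
        med_policy K h i * b (rewards_of h i) +
        med_policy K h j * v (rewards_of h j))%R) ->
    'E_P[fun w => (pulls J i N w)%:R] <= (C + L%:R + c *+ N)%:E.
Proof.
move=> b0 v0 db dv.
have sum1 n h : h \in histories S n -> (0 < hist_prob J X n h)%R ->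
    (\sum_(k < K) med_policy K h k = 1)%R.
  move=> hn h0; apply: (med_policy_sum1 i) => Kh.
  by apply: (explored_histories hn h0); rewrite -(size_histories hn).
have [C hC] := drift_pulls_bound FS run sum1 (@med_policy_ge0 _ _) db dv.
exists (C + K%:R)%R => L c N c0 H.
pose cn n : R := ((n < K)%N%:R + c)%R.
apply: (@le_trans _ _ (C + L%:R + \sum_(n < N) cn n)%:E).
  apply: hC => n h hn h0.
  have p0 k := med_policy_ge0 h k.
  rewrite /cn; case: (ltnP n K) => [nK|Kn].
    have p1 : (med_policy K h i <= 1)%R.
      rewrite /med_policy (size_histories hn) nK; by case: (_ == _).
    have := mulr_ge0 (p0 i) (ler0n R (size (rewards_of h i) < L)%N).
    have := mulr_ge0 (p0 i) (b0 (rewards_of h i)).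
    have := mulr_ge0 (p0 j) (v0 (rewards_of h j)).
    rewrite /= mulr1n; lra.
  rewrite add0r; apply: H.
  - exact: explored_histories hn h0 Kn.
  - by rewrite (size_histories hn).
  - by move=> k; exact: rewards_support hn.
rewrite lee_fin /cn big_split /= sumr_const card_ord.
have : (\sum_(n < N) (n < K)%N%:R <= K%:R :> R)%R; last by lra.
rewrite -natr_sum ler_nat; apply: (@leq_trans (minn N K)); last exact: geq_minr.
elim: (N) => [|n IH]; first by rewrite big_ord0.
rewrite big_ord_recr /=; apply: (leq_trans (leq_add IH (leqnn _))).
by case: ltnP; lia.
Qed.
End Run_of_med.

(** * Continuity of the minimum divergence *)

Section Analytic.
Context {R : realType}.
Local Notation dist := (probability (measurableTypeR R) R).

Lemma dirac0_law : exists G : dist, atomic_on G [:: 0%R] /\ mean G = 0.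
Proof.
exists (empirical [:: 0%R]); split.
  apply: (@atomic_on_empirical _ [:: 0%R]) => // x; rewrite inE => /eqP ->.
  by rewrite lexx lerN10.
by rewrite mean_empirical // big_seq1 mul0r.
Qed.

(** Mixing [G] with the Dirac mass at 0 multiplies its mean by [1 - l], which brings
it closer to 0, at the price [- ln (1 - l)] of [KL_dominated]. *)
Lemma Dmin_relax (F G : dist) s (mu g c l : R) : atomic_on F s ->
  finsupp_family G -> mean G = g%:E -> (0 <= l < 1)%R -> (mu <= (1 - l) * g)%R ->
  c%:E <= Dmin F mu%:E -> (c + ln (1 - l))%:E <= KL F G.
Proof.
move=> Fs /family_atomic_on[t Gt] Gg /andP[l0 l1] mug cD.
have [Z [Zs Z0]] := dirac0_law.
have [|H [HA Hatom Hmean]] := @mixture _ l G Z t [:: 0%R] _ Gt Zs.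
  by rewrite l0 ltW.
apply: (@KL_dominated _ F G H s (1 - l) c) => //.
- by rewrite subr_gt0.
- by move=> x; rewrite Hatom lerDl mulr_ge0 // atom_ge0.
- apply: (le_trans cD); apply: Dmin_le => //.
  by rewrite Hmean Z0 mule0 adde0 Gg -EFinM lee_fin.
Qed.

Lemma ln_1B_ge (x : R) : (0 <= x <= 1 / 2 -> - (2 * x) <= ln (1 - x))%R.
Proof.
move=> /andP[x0 x1]; have y0 : (0 < 1 - x)%R by lra.
have := @ln_ler_sub1 _ (1 - x)^-1; rewrite invr_gt0 lnV ?posrE // => /(_ y0) h.
have : ((1 - x)^-1 <= 1 + 2 * x)%R.
  by rewrite -[leLHS]mul1r ler_pdivrMr //; nra.
lra.
Qed.

(** As [l] tends to 0 the right-hand side tends to [D > D / (1 + eps)].  The bound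
[ln (1 - l) >= - 2 l] makes the loss at most [l * (D + 4 + 2 * H)]. *)
Lemma slack_constant (D H eps : R) : (0 < D)%R -> (0 <= H)%R -> (0 < eps)%R ->
  exists l, (0 < l <= 1 / 2)%R /\
   (D / (1 + eps) <= (1 - l) * (D + ln (1 - l)) + ln (1 - l) - 2 * l * H)%R.
Proof.
move=> D0 H0 e0.
have e1 : (0 < 1 + eps)%R by lra.
set c := (D / (1 + eps))%R.
have cD : (c < D)%R by rewrite /c ltr_pdivrMr //; nra.
have q0 : (0 < D + 4 + 2 * H)%R by lra.
pose l := Num.min (1 / 2)%R ((D - c) / (D + 4 + 2 * H))%R.
have l0 : (0 < l)%R.
  by rewrite /l lt_min; apply/andP; split; [lra | apply: divr_gt0; lra].
have l1 : (l <= 1 / 2)%R by rewrite /l ge_min lexx.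
have l2 : (l * (D + 4 + 2 * H) <= D - c)%R.
  by rewrite -ler_pdivlMr // /l ge_min lexx orbT.
exists l; rewrite l0 l1; split => //.
have h : (- (2 * l) <= ln (1 - l))%R by apply: ln_1B_ge; rewrite l1 ltW.
have h' : (ln (1 - l) <= 0)%R by apply: ln_le0; lra.
nra.
Qed.

End Analytic.
(** * Bounds on the pulls of a suboptimal arm *)

Section Assembly.
Context {R : realType}.
Local Notation dist := (probability (measurableTypeR R) R).

Lemma has_drift_scale s (p : R -> R) b (k : R) : (0 <= k)%R -> has_drift s p b ->
  has_drift s p (fun x => k * b x)%R.
Proof.
move=> k0 [B [B0 h]]; exists (fun x => k * B x)%R; split=> x.
  by rewrite mulr_ge0.
under eq_bigr do rewrite mulrCA.
by rewrite -mulr_sumr -mulrDr ler_wpM2l.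
Qed.

Lemma mean_real (F : dist) s : atomic_on F s ->
  exists2 g : R, mean F = g%:E & (-1 <= g <= 0)%R.
Proof.
move=> [us s01 Fpos F0]; exists (\sum_(x <- s) x * atom F x)%R.
  exact: mean_atomic.
apply/andP; split.
  rewrite -(sum_atom us F0) -sumrN big_seq [leRHS]big_seq; apply: ler_sum => x xs.
  by have := s01 x xs; have := Fpos x xs; nra.
rewrite big_seq sumr_le0 // => x xs.
by have := s01 x xs; have := Fpos x xs; nra.
Qed.

(** Lower semicontinuity of the minimum divergence in both arguments, in
quantitative form: the competitors of [empirical x] with mean above the lowered
threshold are compared with those of [F] by [KL_stable] and [Dmin_relax]. *)
Lemma Dmin_freq_close (F : dist) s (mu D l hm : R) x : atomic_on F s -> (mu < 0)%R ->
  D%:E <= Dmin F mu%:E -> (0 < l <= 1 / 2)%R -> x != [::] -> {subset x <= s} ->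
  freq_close F s l x -> (mu * (1 + l) <= hm)%R ->
  ((1 - l) * (D + ln (1 - l)) + ln (1 - l) - 2 * l * entropy F s)%:E
    <= Dmin (empirical x) hm%:E.
Proof.
move=> Fs mu0 FD /andP[l0 l1] x0 xs cl hmm.
have l11 : (l < 1)%R by lra.
apply/ereal_infP => _ [G [GA /= Gm] <-].
have [t Gt] := family_atomic_on GA; have [g gE _] := mean_real Gt.
rewrite gE lee_fin in Gm.
apply: (KL_stable Fs (atomic_on_freq_close Fs l11 x0 xs cl) _ cl); first by rewrite ltW.
apply: (Dmin_relax Fs GA gE _ _ FD); first by rewrite ltW.
nra.
Qed.

(** When the largest empirical mean is low, the optimal arm is still pulled with a
probability bounded below in terms of its own rewards: the mixture of [F] and the
empirical law with weight [l * - mu] on the latter is an admissible competitor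
because its mean is at least [mu - l * - mu = mu * (1 + l)]. *)
Lemma low_mean_pull (K : nat) (F : dist) s (mu l w : R) (j : 'I_K)
    (h : history (R := R) K) :
  atomic_on F s -> mean F = mu%:E -> (-1 <= mu < 0)%R -> (0 < l < 1)%R ->
  explored h -> (K <= size h)%N -> {subset rewards_of h j <= s} ->
  best_mean (empirical_dist h) <= (mu * (1 + l))%:E ->
  let x := rewards_of h j in
  (\sum_(a <- x) a <= mu * (1 + l) * (size x)%:R -> 
    expR ((1 - l * - mu) * \sum_(a <- x) ln (atom (empirical x) a / atom F a)) <= w)%R ->
  (1 <= med_policy K h j * (K%:R * w))%R.
Proof.
move=> Fs Fmu /andP[mu1 mu0] /andP[l0 l1] hx Kh xs hm x hw.
set d := (l * - mu)%R in hw.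
have d01 : (0 <= d <= 1)%R by rewrite /d; apply/andP; split; nra.
have [x0 x01] := hx j; have xc := atomic_on_explored j hx.
have n0 : (0 < (size x)%:R :> R)%R by rewrite ltr0n lt0n size_eq0.
have [us s01 Fpos F0] := Fs.
have [g gE /andP[g1 _]] := mean_real xc.
have gbest : mean (empirical x) <= best_mean (empirical_dist h).
  exact: (le_best_mean (empirical_dist h) j).
have sumx : (\sum_(a <- x) a <= mu * (1 + l) * (size x)%:R)%R.
  by have := le_trans gbest hm; rewrite mean_empirical // lee_fin ler_pdivrMr.
have {hw} wge := hw sumx.
set Q := ((1 - d) * _)%R in wge.
have Fpos' : {in undup x, forall a, 0 < atom F a}%R.
  by move=> a; rewrite mem_undup => /xs; exact: Fpos.
have [H [HA Hatom Hmean]] := mixture d01 Fs xc.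
have kl := KL_mixture xc d01 Fpos' Hatom.
rewrite (sum_empirical (fun a => ln (atom (empirical x) a / atom F a))) // in kl.
have Dle : med_divergence h j <= (Q / (size x)%:R)%:E.
  rewrite /Q -mulrA; apply: le_trans kl; apply: Dmin_le => //.
  rewrite Hmean Fmu gE -!EFinM -EFinD; apply: (le_trans hm); rewrite lee_fin.
  by rewrite /d in d01 *; nra.
have := med_weight_ge (med_divergence_ge0 j hx) Dle.
rewrite -/x mulrC divfK ?gt_eqF // => wj.
have [_ _ pj] := med_policy_late j hx Kh.
have K0 : (0 < K%:R :> R)%R by rewrite ltr0n; apply: leq_ltn_trans (ltn_ord j).
have e0 := expR_gt0 Q; have eQ : (expR (- Q) * expR Q = 1)%R by rewrite -expRD addNr expR0.
apply: (@le_trans _ _ (med_weight h j * w)%R).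
  rewrite -eQ; apply: ler_pM => //; exact: expR_ge0.
rewrite mulrA ler_wpM2r //; first exact: le_trans (ltW e0) wge.
by rewrite -ler_pdivrMr.
Qed.

(** Mixing [F] with the Dirac mass at 0 gives a competitor of mean
[- mu * g >= mu] whose divergence is at most [- ln (- mu)]. *)
Lemma Dmin_fin (F : dist) s (mu g : R) : atomic_on F s -> mean F = g%:E -> (-1 <= g)%R ->
  (-1 < mu < 0)%R -> Dmin F mu%:E < +oo.
Proof.
move=> Fs Fg g1 /andP[mu1 mu0]; rewrite ltNge; apply/negP; rewrite leye_eq => /eqP DE.
have FA := atomic_on_family Fs.
have : (1 - ln (- mu))%:E <= Dmin F mu%:E by rewrite DE leey.
move=> /(Dmin_relax (l := 1 + mu) Fs FA Fg).
rewrite (KL_self Fs) lee_fin (_ : 1 - (1 + mu) = - mu)%R; last by ring.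
rewrite subrK ler10 => /(_ _ _)/notF; apply; last by nra.
by apply/andP; split; lra.
Qed.

Section Main.
Context (K : nat) (F : 'I_K -> dist) (S : 'I_K -> seq R).
Hypothesis FS : forall k, atomic_on (F k) (S k).
Context {d : measure_display} {Omega : measurableType d}.
Context {P : probability Omega R}.
Variables (J : nat -> Omega -> 'I_K) (X : nat -> {RV P >-> R}).
Hypothesis run : bandit_run J X F (med_policy K).
Variables (i j : 'I_K).

(** The case of a negative largest mean.  The error terms per round add up to
[N * (1 / N) = 1], and rounding [ln N / c] up to the integer [L] costs 1 more:
hence the 2 in the constant. *)
Lemma pulls_log_bound (mu D eps : R) : mean (F j) = mu%:E -> (-1 <= mu < 0)%R ->
  (0 < D)%R -> Dmin (F i) mu%:E = D%:E -> (0 < eps)%R ->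
  exists C : R, forall N, (0 < N)%N ->
    'E_P[fun w => (pulls J i N w)%:R] <=
      ((1 + eps) / D * ln N%:R + C)%:E.
Proof.
move=> Fj mu01 D0 DE eps0; have /andP[mu1 mu0] := mu01.
have [l [/andP[l0 l1] hl]] := slack_constant D0 (entropy_ge0 (F i) (S i)) eps0.
set c := (D / (1 + eps))%R in hl.
have c0 : (0 < c)%R by apply: divr_gt0 => //; lra.
have [|b [b0 db hb]] := @not_close_drift _ (F i) (S i) l (FS i).
  by rewrite l0 /=; lra.
have [usj _ _ F0j] := FS j.
have [|||v [v0 dv hv]] := @low_mean_drift _ (F j) (S j) (mu * (1 + l)) (l * - mu) (FS j).
- by apply/andP; split; nra.
- by apply/andP; split; nra.
- have : mu = (\sum_(a <- S j) atom (F j) a * a)%R.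
    apply: EFin_inj; rewrite -Fj (mean_atomic usj F0j); congr _%:E.
    by apply: eq_bigr => a _; rewrite mulrC.
  by move=> <-; nra.
have Kv0 x : (0 <= K%:R * v x)%R by rewrite mulr_ge0.
have dKv := has_drift_scale (ler0n R K) dv.
have [C hC] := med_pulls_bound FS run b0 Kv0 db dKv.
exists (C + 2)%R => N N0.
have N0R : (0 < N%:R :> R)%R by rewrite ltr0n.
have lnN : (0 <= ln (N%:R : R))%R by rewrite ln_ge0 // ler1n.
pose L := (Num.truncn (ln (N%:R : R) / c)).+1.
have L1 : (ln N%:R / c <= L%:R :> R)%R by rewrite ltW // truncnS_gt.
have L2 : (L%:R <= ln N%:R / c + 1 :> R)%R.
  by rewrite /L -addn1 natrD lerD2r Num.Theory.truncn_le divr_ge0 // ltW.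
apply: (@le_trans _ _ (C + L%:R + N%:R^-1 *+ N)%:E).
  apply: hC => [|h hx Kh hS]; first by rewrite invr_ge0.
  have [p1 pw _] := med_policy_late i hx Kh.
  have p0 := med_policy_ge0 h i; have q0 := med_policy_ge0 h j.
  set x := rewards_of h i in hx Kh *.
  have t1 := mulr_ge0 p0 (ler0n R (size x < L)%N).
  have t2 := mulr_ge0 p0 (b0 x).
  have t3 := mulr_ge0 q0 (Kv0 (rewards_of h j)).
  have t0 : (0 <= N%:R^-1 :> R)%R by rewrite invr_ge0.
  have [x0 _] := hx i.
  have [xL|Lx] := ltnP (size x) L; first by rewrite mulr1; lra.
  rewrite mulr0 addr0.
  have [cl|/(hb x x0) b1] := pselect (freq_close (F i) (S i) l x); last first.
    by have := ler_wpM2l p0 b1; rewrite mulr1; lra.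
  have [lo|hi] := leP (best_mean (empirical_dist h)) (mu * (1 + l))%:E.
    have := low_mean_pull (FS j) Fj mu01 _ hx Kh (hS j) lo (hv _ (hx j).1 (hS j)).
    by rewrite l0 /= => /(_ ltac:(lra)) lm; lra.
  suff : (med_weight h i <= N%:R^-1)%R by lra.
  have [k kE] := best_mean_attained (empirical_dist h) j.
  have [hm hmE _] := mean_real (atomic_on_explored k hx).
  have Dc : c%:E <= med_divergence h i.
    rewrite /med_divergence kE hmE; rewrite kE hmE lte_fin in hi.
    apply: le_trans (Dmin_freq_close (FS i) mu0 _ _ x0 (hS i) cl (ltW hi)).
    - by rewrite lee_fin; exact: hl.
    - by rewrite DE.
    - by rewrite l0.
  apply: (le_trans (med_weight_le x0 (med_divergence_ge0 i hx) Dc)).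
  rewrite -[leRHS]lnK ?posrE ?invr_gt0 // ler_expR lnV ?posrE // lerN2.
  apply: (@le_trans _ _ (L%:R * c)%R); first by rewrite -ler_pdivrMr.
  by rewrite ler_wpM2r ?ler_nat // ltW.
rewrite lee_fin -[(_ *+ N)%R]mulr_natr mulVf ?gt_eqF //.
have -> : ((1 + eps) / D * ln N%:R = ln N%:R / c)%R.
  rewrite /c; field; apply/andP; split; rewrite gt_eqF //; lra.
lra.
Qed.

(** The case of largest mean 0: all rewards of arm [j] are 0, so the largest
empirical mean is 0, and a competitor of mean at least 0 charges no negative
point. *)
Lemma pulls_bounded (g : R) : mean (F j) = 0 -> mean (F i) = g%:E -> (g < 0)%R ->
  exists C : R, forall N, 'E_P[fun w => (pulls J i N w)%:R] <= C%:E.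
Proof.
move=> Fj Fi g0.
have [usj s01j Fposj F0j] := FS j; have [usi s01i Fposi F0i] := FS i.
have Sj0 a : a \in S j -> a = 0%R.
  move=> aS; move: Fj; rewrite (mean_atomic usj F0j) => -[].
  have le0 y : y \in S j -> (y * atom (F j) y <= 0)%R.
    by move=> yS; have := s01j y yS; have := Fposj y yS; nra.
  rewrite (bigD1_seq a) //=; have := le0 a aS.
  have : (\sum_(y <- S j | y != a) y * atom (F j) y <= 0)%R.
    by rewrite big_seq_cond sumr_le0 // => y /andP[/le0].
  move=> h1 h2 h3; have /eqP : (a * atom (F j) a = 0)%R by lra.
  by rewrite mulf_eq0 (gt_eqF (Fposj a aS)) orbF => /eqP.
have [a aS a0] : exists2 a, a \in S i & (a < 0)%R.
  apply: contrapT => na; suff : (g = 0)%R by lra.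
  apply: EFin_inj; rewrite -Fi (mean_atomic usi F0i) big_seq big1 // => y yS.
  have /andP[_] := s01i y yS; rewrite le_eqVlt => /orP[/eqP ->|y0].
    by rewrite mul0r.
  by case: na; exists y.
have [|b [b0 db hb]] := @not_close_drift _ (F i) (S i) (1 / 2) (FS i).
  by apply/andP; split; lra.
have [C hC] := med_pulls_bound FS run b0 (fun=> lexx 0%R) db (has_drift0 (S j) (atom (F j))).
exists C => N; rewrite (_ : C = C + 0%N%:R + 0 *+ N)%R; last by rewrite mul0rn !addr0.
apply: hC => // h hx Kh hS.
rewrite ltn0 !mulr0 !addr0 !add0r.
have [p1 pw _] := med_policy_late i hx Kh; have p0 := med_policy_ge0 h i.
set x := rewards_of h i in hx Kh *; have [x0 x01] := hx i.
have [cl|/(hb x x0) b1] := pselect (freq_close (F i) (S i) (1 / 2) x); last by nra.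
suff : med_weight h i = 0%R by have := b0 x; nra.
apply: med_weight_infty => //.
have best0 : 0 <= best_mean (empirical_dist h).
  apply: le_trans (le_best_mean (empirical_dist h) j).
  rewrite mean_empirical ?(hx j).1 // big_seq big1 ?mul0r // => y /(hS j)/Sj0 //.
apply/eqP; rewrite -leye_eq; apply/ereal_infP => _ [G [GA /= Gm] <-].
rewrite leye_eq; apply/eqP; apply: (@KL_pinfty _ _ _ a).
  have /andP[+ _] := cl a aS; apply: lt_le_trans; rewrite mulr_gt0 ?Fposi //; lra.
have [t [ut t01 tpos G0]] := family_atomic_on GA.
have [ta|nta] := boolP (a \in t); last exact: atom_notin G0 nta.
have := le_trans best0 Gm; rewrite (mean_atomic ut G0) lee_fin (bigD1_seq a) //=.
have : (\sum_(y <- t | y != a) y * atom G y <= 0)%R.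
  rewrite big_seq_cond sumr_le0 // => y /andP[yt _].
  by have := t01 y yt; have := tpos y yt; nra.
by have := tpos a ta; nra.
Qed.

End Main.
End Assembly.

Theorem theorem3 (R : realType) (K : nat)
    (F : 'I_K -> probability (measurableTypeR R) R)
    (F_in_family : forall k : 'I_K, finsupp_family (F k))
    (j : 'I_K)
    (j_optimal : mean (F j) = best_mean F)
    (j_unique : forall i : 'I_K, i != j -> mean (F i) < best_mean F)
    (d : measure_display) (Omega : measurableType d)
    (P : probability Omega R)
    (J : nat -> Omega -> 'I_K) (X : nat -> {RV P >-> R})
    (run : bandit_run J X F (med_policy K))
    (i : 'I_K) (i_neq_j : i != j) (eps : R) (eps_gt0 : (0 < eps)%R) :
  exists C : R, \forall N \near \oo,
    'E_P[fun w => (pulls J i N w)%:R] <=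
      (1 + eps)%:E / Dmin (F i) (best_mean F) * (ln N%:R)%:E + C%:E.
Proof.
have [S FS] := choice (fun k => family_atomic_on (F_in_family k)).
have [mu muE /andP[mu1 mu0]] := mean_real (FS j).
have [g gE /andP[g1 _]] := mean_real (FS i).
have gmu : (g < mu)%R.
  by have := j_unique i i_neq_j; rewrite -j_optimal muE gE lte_fin.
rewrite -j_optimal muE.
have D0 := Dmin_ge0 mu%:E (FS i).
have e1 : (0 < 1 + eps)%R by lra.
move: mu0; rewrite le_eqVlt => /orP[/eqP mu0|mu0].
  rewrite mu0 in muE D0 *; have gn : (g < 0)%R by rewrite -mu0.
  have [C hC] := pulls_bounded FS run muE gE gn.
  exists C; near=> N; apply: (le_trans (hC N)).
  rewrite -[leLHS]add0e leeD2r // mule_ge0 //.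
    by apply: mule_ge0; [rewrite lee_fin ltW | rewrite inve_ge0].
  by rewrite lee_fin ln_ge0 // ler1n; near: N; exact: nbhs_infty_ge.
have Dfin : Dmin (F i) mu%:E < +oo.
  by apply: (Dmin_fin (FS i) gE g1); rewrite mu0 andbT; lra.
case DE : (Dmin (F i) mu%:E) D0 Dfin => [D| |] //.
rewrite lee_fin le_eqVlt => /orP[/eqP <-|D0] _.
  exists 0%R; near=> N.
  have lnN : (0 < ln (N%:R : R))%R.
    by rewrite ln_gt0 // ltr1n; near: N; exact: nbhs_infty_gt.
  by rewrite inve0 gt0_muley ?lte_fin // gt0_mulye ?lte_fin // adde0 leey.
have mu01 : (-1 <= mu < 0)%R by rewrite mu1.
have [C hC] := pulls_log_bound FS run muE mu01 D0 DE eps_gt0.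
exists C; near=> N.
rewrite inver gt_eqF // -!EFinM -EFinD; apply: hC.
by near: N; exact: nbhs_infty_gt.
Unshelve. all: by end_near.
Qed.
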